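(* Let $\mathfrak{g}_{4|2}^{3}$ be the complex Lie superalgebra of dimension $4|2$ with basis $\{e_1,e_2,e_3,e_4\mid e_5,e_6\}$ ($e_1,\dots,e_4$ even, $e_5,e_6$ odd) and nontrivial brackets \begin{align*} &[e_1,e_2]=e_2,\ [e_1,e_3]=-e_3,\ [e_2,e_3]=e_4,\ [e_1,e_5]=\tfrac12e_5,\ [e_1,e_6]=-\tfrac12e_6,\\ &[e_2,e_6]=e_5,\ [e_5,e_6]=\tfrac12e_4,\ [e_6,e_6]=e_3. \end{align*} Then $\mathfrak{g}_{4|2}^{3}$ has only one (nontrivial) metric deformation, up to equivalence and change of parameter, and it is a jump deformation to $\mathfrak{osp}(1,2)\oplus\mathbb{C}_{1|0}$.
   Context: All Lie superalgebras are over $\mathbb{C}$. Brackets of basis elements that are not listed are zero or determined by $[y,x]=-(-1)^{|x||y|}[x,y]$. $\mathbb{C}_{m|n}$ is the abelian Lie superalgebra of dimension $m|n$. $\mathfrak{osp}(1,2)$ is the $3|2$-dimensional Lie superalgebra with basis $\{e_1,e_2,e_3\mid e_4,e_5\}$ and nontrivial brackets $[e_1,e_2]=e_3$, $[e_1,e_3]=-2e_1$, $[e_2,e_3]=2e_2$, $[e_1,e_5]=-e_4$, $[e_2,e_4]=-e_5$, $[e_3,e_4]=e_4$, $[e_3,e_5]=-e_5$, $[e_4,e_4]=\frac12e_1$, $[e_4,e_5]=\frac14e_3$, $[e_5,e_5]=-\frac12e_2$. A metric Lie superalgebra is a Lie superalgebra together with an even, non-degenerate, supersymmetric bilinear form $B$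 that is invariant: $B([x,y],z)=B(x,[y,z])$. A formal 1-parameter deformation of a Lie superalgebra $(\mathfrak g,[\ ,\ ])$ is a $\mathbb{C}[[t]]$-bilinear Lie superalgebra structure on $\mathfrak g[[t]]=\mathfrak g\otimes_{\mathbb C}\mathbb{C}[[t]]$ of the form $[\ ,\ ]_t=[\ ,\ ]+\sum_{i\ge1}t^i\phi_i$, each $\phi_i:\mathfrak g\times\mathfrak g\to\mathfrak g$ being an even super-skew-symmetric bilinear map. Two such deformations $[\ ,\ ]_t,[\ ,\ ]'_t$ are equivalent if there is $\widehat\psi_t=\mathrm{id}+\psi_1t+\psi_2t^2+\cdots$ with even linear $\psi_i:\mathfrak g\to\mathfrak g$ and $\widehat\psi_t([x,y]_t)=[\widehat\psi_t(x),\widehat\psi_t(y)]'_t$ for all $x,y\in\mathfrak g$. A deformation is trivial if it is equivalent to the original bracket. A metric deformation is a formal 1-parameter deformation that defines a metric Lie superalgebra, i.e. $(\mathfrak g[[t]],[\ ,\ ]_t)$ admits an even, supersymmetric, invariant $\mathbb{C}[[t]]$-bilinear form that is non-degenerate over $\mathbb{C}[[t]]$ (induces an isomorphism with the dual module). A deformation is a jump deformation to $\mathfrak h$ if for every non-zero value of $t$ near the origin it gives an algebra isomorphic to the same Lie superalgebra $\mathfrak h$, which is not isomorphic to $\mathfrak g$. *)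

(* Defs.v *)
From HB Require Import structures.
From mathcomp Require Import all_boot all_order all_algebra.
From mathcomp Require Import boolp classical_sets reals topology normedtype.
From mathcomp Require Import sequences complex.

Set Implicit Arguments.
Unset Strict Implicit.
Unset Printing Implicit Defensive.

Import Order.TTheory GRing.Theory Num.Theory.
Import numFieldNormedType.Exports.

Local Open Scope ring_scope.

Section LieSuperalgebras.
Variable K : comNzRingType.

(* The complex field is R[i], for R : realType.
   A superspace is a pair (V0, V1) of K-modules, the even and the odd part; its
   elements are the pairs x = (x.1, x.2) : V0 * V1. *)

Definition homogeneous (V0 V1 : lmodType K) (p : bool) (x : V0 * V1) : Prop :=
  if p then x.1 = 0 else x.2 = 0.

Definition even_map (V0 V1 W0 W1 : lmodType K) (f : V0 * V1 -> W0 * W1) : Prop :=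
  forall p x, homogeneous p x -> homogeneous p (f x).

Section Bracket.
Variables (V0 V1 : lmodType K).
Let V := (V0 * V1)%type.

Record even_super_skew (br : V -> V -> V) : Prop := EvenSuperSkew {
  _ : forall x, linear (br x);
  _ : forall y, linear (br^~ y);
  _ : forall p q x y, homogeneous p x -> homogeneous q y ->
      homogeneous (p (+) q) (br x y);
  _ : forall p q x y, homogeneous p x -> homogeneous q y ->
      br y x = - ((-1) ^+ (p && q) *: br x y)
}.

(* The module may live over C[[t]], where 2 and 3 are still invertible, so that
   no extra axiom is needed besides super-skew-symmetry and super-Jacobi. *)
Definition lie_superalgebra (br : V -> V -> V) : Prop :=
  even_super_skew br /\
  forall p q x y z, homogeneous p x -> homogeneous q y ->
    br x (br y z) = br (br x y) z + (-1) ^+ (p && q) *: br y (br x z).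

(* The last field says that x |-> B(x, -) is a bijection onto the dual module:
   non-degeneracy over K. *)
Record metric_form (br : V -> V -> V) (B : V -> V -> K) : Prop := MetricForm {
  _ : forall x, linear (B x : V -> K^o);
  _ : forall y, linear (B^~ y : V -> K^o);
  _ : forall p x y, homogeneous p x -> homogeneous (~~ p) y -> B x y = 0;
  _ : forall p q x y, homogeneous p x -> homogeneous q y ->
      B x y = (-1) ^+ (p && q) * B y x;
  _ : forall x y z, B (br x y) z = B x (br y z);
  _ : forall l : {linear V -> K^o}, exists! x, forall y, B x y = l y
}.

Definition metric_lie_superalgebra (br : V -> V -> V) : Prop :=
  lie_superalgebra br /\ exists B, metric_form br B.

End Bracket.

Definition lie_isomorphic (V0 V1 W0 W1 : lmodType K)
    (brV : V0 * V1 -> V0 * V1 -> V0 * V1)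
    (brW : W0 * W1 -> W0 * W1 -> W0 * W1) : Prop :=
  exists f : {linear (V0 * V1)%type -> (W0 * W1)%type},
    [/\ even_map f, bijective f & forall x y, f (brV x y) = brW (f x) (f y)].

Definition lie_dsum (V0 V1 W0 W1 : lmodType K)
    (brV : V0 * V1 -> V0 * V1 -> V0 * V1)
    (brW : W0 * W1 -> W0 * W1 -> W0 * W1)
    (x y : (V0 * W0) * (V1 * W1)) : (V0 * W0) * (V1 * W1) :=
  let v := brV (x.1.1, x.2.1) (y.1.1, y.2.1) in
  let w := brW (x.1.2, x.2.2) (y.1.2, y.2.2) in
  ((v.1, w.1), (v.2, w.2)).

End LieSuperalgebras.

(* K^{m|n} *)
Definition svec (K : Type) (m n : nat) : Type := ('rV[K]_m * 'rV[K]_n)%type.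

Definition lie_abelian (K : comNzRingType) (m n : nat) (x y : svec K m n) :
  svec K m n := 0.

Section StructureConstants.
Variables (K : numFieldType) (m n : nat).

(* The homogeneous basis e_1, ..., e_m | e_(m+1), ..., e_(m+n), with indices
   starting at 1. *)
Definition sbasis (k : nat) : svec K m n :=
  (\row_(i < m) (i.+1 == k)%:R, \row_(i < n) (m + i.+1 == k)%N%:R).

(* [c i j] is [e_i, e_j] for i <= j; the other brackets of basis elements are
   given by super-skew-symmetry, e_i being odd iff m < i. *)
Definition table_bracket (c : nat -> nat -> svec K m n) (x y : svec K m n) :
    svec K m n :=
  let b i j := if (i <= j)%N then c i j
               else - ((-1) ^+ ((m < i)%N && (m < j)%N) *: c j i) in
  \sum_(i < m + n) \sum_(j < m + n)
    (row_mx x.1 x.2 0 i * row_mx y.1 y.2 0 j) *: b i.+1 j.+1.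

End StructureConstants.

Definition g4232 (K : numFieldType) : svec K 4 2 -> svec K 4 2 -> svec K 4 2 :=
  let e := @sbasis K 4 2 in
  table_bracket (fun i j =>
    match i, j with
    | 1%N, 2%N => e 2%N
    | 1%N, 3%N => - e 3%N
    | 2%N, 3%N => e 4%N
    | 1%N, 5%N => 2^-1 *: e 5%N
    | 1%N, 6%N => - (2^-1 *: e 6%N)
    | 2%N, 6%N => e 5%N
    | 5%N, 6%N => 2^-1 *: e 4%N
    | 6%N, 6%N => e 3%N
    | _, _ => 0
    end).

Definition osp12 (K : numFieldType) : svec K 3 2 -> svec K 3 2 -> svec K 3 2 :=
  let e := @sbasis K 3 2 in
  table_bracket (fun i j =>
    match i, j with
    | 1%N, 2%N => e 3%N
    | 1%N, 3%N => - (2 *: e 1%N)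
    | 2%N, 3%N => 2 *: e 2%N
    | 1%N, 5%N => - e 4%N
    | 2%N, 4%N => - e 5%N
    | 3%N, 4%N => e 4%N
    | 3%N, 5%N => - e 5%N
    | 4%N, 4%N => 2^-1 *: e 1%N
    | 4%N, 5%N => 4^-1 *: e 3%N
    | 5%N, 5%N => - (2^-1 *: e 2%N)
    | _, _ => 0
    end).

(* The ring K[[t]]. *)
Record fps (K : Type) : Type := Fps { coef_fps : nat -> K }.

HB.instance Definition _ (K : Type) := gen_eqMixin (fps K).
HB.instance Definition _ (K : Type) := gen_choiceMixin (fps K).

Lemma fpsP (K : Type) (a b : fps K) : coef_fps a =1 coef_fps b -> a = b.
Proof. by case: a b => [a] [b] /= ab; congr Fps; apply: funext. Qed.

Section FpsRing.
Variable K : comNzRingType.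
Implicit Types a b c : fps K.

Definition fps_zero : fps K := Fps (fun=> 0).
Definition fps_opp a : fps K := Fps (fun k => - coef_fps a k).
Definition fps_add a b : fps K := Fps (fun k => coef_fps a k + coef_fps b k).
Definition fps_one : fps K := Fps (fun k => (k == 0%N)%:R).
Definition fps_mul a b : fps K :=
  Fps (fun k => \sum_(i < k.+1) coef_fps a i * coef_fps b (k - i)%N).

Fact fps_addA : associative fps_add.
Proof. by move=> a b c; apply: fpsP => k /=; rewrite addrA. Qed.
Fact fps_addC : commutative fps_add.
Proof. by move=> a b; apply: fpsP => k /=; rewrite addrC. Qed.
Fact fps_add0 : left_id fps_zero fps_add.
Proof. by move=> a; apply: fpsP => k /=; rewrite add0r. Qed.
Fact fps_addN : left_inverse fps_zero fps_opp fps_add.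
Proof. by move=> a; apply: fpsP => k /=; rewrite addNr. Qed.

HB.instance Definition _ :=
  GRing.isZmodule.Build (fps K) fps_addA fps_addC fps_add0 fps_addN.

Let trunc N a : {poly K} := \poly_(i < N) coef_fps a i.

Let fps_mulE N a b k : (k < N)%N ->
  coef_fps (fps_mul a b) k = (trunc N a * trunc N b)`_k.
Proof.
move=> kN; rewrite coefM /=; apply: eq_bigr => i _.
by rewrite !coef_poly (leq_ltn_trans (leq_subr _ _) kN)
           (leq_ltn_trans (leq_ord i) kN).
Qed.

Fact fps_mulA : associative fps_mul.
Proof.
move=> a b c; apply: fpsP => k.
transitivity (trunc k.+1 a * (trunc k.+1 b * trunc k.+1 c))`_k.
  rewrite coefM; apply: eq_bigr => i _; rewrite coef_poly ltn_ord.
  by rewrite (@fps_mulE k.+1) // ltnS leq_subr.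
rewrite mulrA coefM; apply: eq_bigr => i _.
by rewrite -fps_mulE // coef_poly ltnS leq_subr.
Qed.

Fact fps_mulC : commutative fps_mul.
Proof.
by move=> a b; apply: fpsP => k; rewrite !(@fps_mulE k.+1) // mulrC.
Qed.

Fact fps_mul1 : left_id fps_one fps_mul.
Proof.
move=> a; apply: fpsP => k /=; rewrite big_ord_recl /= subn0 mul1r big1 ?addr0//.
by move=> i _; rewrite mul0r.
Qed.

Fact fps_mulDl : left_distributive fps_mul fps_add.
Proof.
move=> a b c; apply: fpsP => k /=; rewrite -big_split /=.
by apply: eq_bigr => i _; rewrite mulrDl.
Qed.

Fact fps_one_neq0 : fps_one != 0.
Proof.
by apply/eqP => /(congr1 (fun a => coef_fps a 0%N))/eqP /=; rewrite oner_eq0.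
Qed.

HB.instance Definition _ := GRing.Zmodule_isComNzRing.Build (fps K)
  fps_mulA fps_mulC fps_mul1 fps_mulDl fps_one_neq0.

End FpsRing.

Section Deformations.
Variables (K : numFieldType) (m n : nat).
Let V := svec K m n.

(* V[[t]] is the free K[[t]]-module svec (fps K) m n; [svec_coef k] and
   [svec_series] translate between its elements and sequences of vectors. *)
Definition svec_coef (k : nat) (x : svec (fps K) m n) : V :=
  (\row_j coef_fps (x.1 0 j) k, \row_j coef_fps (x.2 0 j) k).

Definition svec_series (u : nat -> V) : svec (fps K) m n :=
  (\row_j Fps (fun k => (u k).1 0 j), \row_j Fps (fun k => (u k).2 0 j)).

Definition svec_const (x : V) : svec (fps K) m n :=
  svec_series (fun k => if k == 0%N then x else 0).

(* The K[[t]]-(bi)linear extensions to V[[t]] of x |-> sum_i t^i psi_i(x) and of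
   (x, y) |-> sum_i t^i phi_i(x, y). *)
Definition series_map (psi : nat -> V -> V) (x : svec (fps K) m n) :
    svec (fps K) m n :=
  svec_series (fun k =>
    \sum_(i < k.+1) \sum_(j < k.+1 | (i + j == k)%N) psi i (svec_coef j x)).

Definition series_bracket (phi : nat -> V -> V -> V) (x y : svec (fps K) m n) :
    svec (fps K) m n :=
  svec_series (fun k =>
    \sum_(i < k.+1) \sum_(j < k.+1) \sum_(l < k.+1 | (i + j + l == k)%N)
      phi i (svec_coef j x) (svec_coef l y)).

(* The formal deformation sum_i t^i phi_i of [br] is given by the sequence phi,
   with phi_0 = br. *)
Definition deformation (br : V -> V -> V) (phi : nat -> V -> V -> V) : Prop :=
  [/\ forall x y, phi 0%N x y = br x y,
      forall i, even_super_skew (phi i)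
    & lie_superalgebra (series_bracket phi)].

Definition metric_deformation (br : V -> V -> V) (phi : nat -> V -> V -> V) :
    Prop :=
  deformation br phi /\ metric_lie_superalgebra (series_bracket phi).

Definition equivalent_deformations (phi phi' : nat -> V -> V -> V) : Prop :=
  exists psi : nat -> V -> V,
    [/\ forall x, psi 0%N x = x,
        forall i, linear (psi i),
        forall i, even_map (psi i)
      & forall x y : V,
          series_map psi (series_bracket phi (svec_const x) (svec_const y)) =
          series_bracket phi' (series_map psi (svec_const x))
                              (series_map psi (svec_const y))].

Definition constant_deformation (br : V -> V -> V) (i : nat) (x y : V) : V :=
  if i == 0%N then br x y else 0.

Definition trivial_deformation (br : V -> V -> V) (phi : nat -> V -> V -> V) :
    Prop :=
  equivalent_deformations phi (constant_deformation br).

(* A change of parameter is a substitution t |-> s(t) with s(0) = 0 and s <> 0;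
   s'(0) = 0 is allowed, e.g. t |-> t^2. *)
Definition parameter_change (s : fps K) : Prop := coef_fps s 0%N = 0 /\ s <> 0.

(* The coefficients of sum_i s(t)^i phi_i. As s(0) = 0, the terms with i > k do
   not contribute to the coefficient of t^k. *)
Definition reparametrize (s : fps K) (phi : nat -> V -> V -> V)
    (k : nat) (x y : V) : V :=
  \sum_(i < k.+1) coef_fps (s ^+ i) k *: phi i x y.

Definition bracket_at (phi : nat -> V -> V -> V) (t : K) (brt : V -> V -> V) :
    Prop :=
  forall x y : V,
    ((fun N => (\sum_(i < N) t ^+ i *: phi i x y : 'rV[K]_m * 'rV[K]_n))
       @ \oo --> (brt x y : 'rV[K]_m * 'rV[K]_n))%classic.

Definition jump_deformation (br : V -> V -> V) (phi : nat -> V -> V -> V)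
    (W0 W1 : lmodType K) (brW : W0 * W1 -> W0 * W1 -> W0 * W1) : Prop :=
  [/\ deformation br phi,
      exists2 eps : K, 0 < eps &
        forall t : K, 0 < `|t| < eps ->
          exists brt, bracket_at phi t brt /\ lie_isomorphic brt brW
    & ~ lie_isomorphic brW br].

End Deformations.

(* Main.v *)
Require Import Defs.
From HB Require Import structures.
From mathcomp Require Import all_boot all_order all_algebra.
From mathcomp Require Import ring.
From mathcomp Require Import boolp classical_sets reals topology normedtype.
From mathcomp Require Import sequences complex.

Set Implicit Arguments.
Unset Strict Implicit.
Unset Printing Implicit Defensive.

Import Order.TTheory GRing.Theory Num.Theory.
Import numFieldNormedType.Exports.

Local Open Scope ring_scope.

(* A metric deformation is a Lie superalgebra with a non-degenerate invariant
   form over the local ring K[[t]] which reduces to g_{4|2}^3 modulo t.  A lift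
   E1 of e1 can be chosen which acts on the odd part with weights 1/2 and -1/2,
   on eigenvectors F5 and F6; invariance of the form then forces D = ad E1 to
   satisfy D^3 = D on the even part.  Put E3 = [F6, F6], let E2 be the lift of
   e2 of weight 1 with [E2, F6] = F5, and let [[E2, E3], E2] = s E2.  Then
   E4 = [E2, E3] - s E1 is central, and the Jacobi identity determines all the
   other brackets.  So, up to equivalence, s in t K[[t]] is the only parameter,
   and the deformation is trivial if s = 0 and is the substitution t |-> s in
   the standard one [e2, e3] = e4 + t e1 otherwise. *)

(** Nothing is solved order by order in t. The power series ring enters only as a commutative ring
    [A] with a morphism [ev] to the field, in which every element of non-zero image is invertible.
    Lifts of a basis are then again a basis, and weight arguments run as over a field as long as
    each divisor (2, 3, a difference of weights, a trace) has non-zero reduction. The obstacle is to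
    split the even part into weight spaces of D = ad E1: once D^3 = D is known, (D^2 + D)/2 maps
    into weight 1, which yields E2. Besides this, the form serves to make the odd action traceless,
    and to show that E4 commutes with E3 and acts by zero on the odd part. Triviality of the
    standard deformation is refuted already by the coefficient of t, and the limit algebra differs
    from the original one because only the latter has a non-zero central element inside its derived
    algebra. *)

Notation "x `_{ k }" := (x 0 (inord k))
  (at level 2, right associativity, format "x `_{ k }").

(** * Rows of small length in coordinates *)

Section Rows.
Variable T : Type.

Lemma row4P (x y : 'rV[T]_4) :
  [/\ x`_{0} = y`_{0}, x`_{1} = y`_{1}, x`_{2} = y`_{2} & x`_{3} = y`_{3}] ->
  x = y.
Proof.
move=> [h0 h1 h2 h3]; apply/rowP => i; rewrite -(inord_val i).
by case: i => [[|[|[|[|//]]]]].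
Qed.

Lemma row3P (x y : 'rV[T]_3) :
  [/\ x`_{0} = y`_{0}, x`_{1} = y`_{1} & x`_{2} = y`_{2}] -> x = y.
Proof.
move=> [h0 h1 h2]; apply/rowP => i; rewrite -(inord_val i).
by case: i => [[|[|[|//]]]].
Qed.

Lemma row2P (x y : 'rV[T]_2) :
  x`_{0} = y`_{0} /\ x`_{1} = y`_{1} -> x = y.
Proof.
move=> [h0 h1]; apply/rowP => i; rewrite -(inord_val i).
by case: i => [[|[|//]]].
Qed.
End Rows.

Section RingRows.
Variable A : comNzRingType.

Definition row4 (a b c d : A) : 'rV[A]_4 := \row_(i < 4) [:: a; b; c; d]`_i.
Definition row3 (a b c : A) : 'rV[A]_3 := \row_(i < 3) [:: a; b; c]`_i.
Definition row2 (a b : A) : 'rV[A]_2 := \row_(i < 2) [:: a; b]`_i.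

Lemma row4E a b c d : ((row4 a b c d)`_{0} = a) * ((row4 a b c d)`_{1} = b) *
  ((row4 a b c d)`_{2} = c) * ((row4 a b c d)`_{3} = d).
Proof. by rewrite !mxE !inordK. Qed.

Lemma row3E a b c : ((row3 a b c)`_{0} = a) * ((row3 a b c)`_{1} = b) *
  ((row3 a b c)`_{2} = c).
Proof. by rewrite !mxE !inordK. Qed.

Lemma row2E a b : ((row2 a b)`_{0} = a) * ((row2 a b)`_{1} = b).
Proof. by rewrite !mxE !inordK. Qed.
End RingRows.

(* With 2 o = 1, s = 0 this is g_{4|2}^3, and s deforms [e2, e3] = e4 to
   e4 + 2 s e1.  Keeping o as a variable makes the bracket linear in (o, s), so
   that a deformation inside the family is a pair of power series. *)
Section Family.
Variable A : comNzRingType.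

Definition family_bracket (o s : A) (x y : svec A 4 2) : svec A 4 2 :=
  let a := x.1 in let b := y.1 in let f := x.2 in let g := y.2 in
  (row4
    (2 * s * (a`_{1} * b`_{2} - a`_{2} * b`_{1})
       + s * (f`_{0} * g`_{1} + f`_{1} * g`_{0}))
    (2 * o * (a`_{0} * b`_{1} - a`_{1} * b`_{0}) - s * (f`_{0} * g`_{0}))
    (2 * o * (f`_{1} * g`_{1} - a`_{0} * b`_{2} + a`_{2} * b`_{0}))
    (2 * o * (a`_{1} * b`_{2} - a`_{2} * b`_{1})
       + o * (f`_{0} * g`_{1} + f`_{1} * g`_{0})),
   row2
    (o * (a`_{0} * g`_{0} - b`_{0} * f`_{0})
       + 2 * o * (a`_{1} * g`_{1} - b`_{1} * f`_{1}))
    (s * (a`_{2} * g`_{0} - b`_{2} * f`_{0})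
       - o * (a`_{0} * g`_{1} - b`_{0} * f`_{1}))).
End Family.

Ltac coords :=
  rewrite /family_bracket; apply: injective_projections => /=;
  [apply: row4P; split | apply: row2P; split];
  rewrite ?(row4E, row2E, mxE) /= ?(row4E, row2E, mxE).

(** * Lie axioms and invariant form of the family *)

Section FamilyLie.
Variable A : comNzRingType.
Implicit Types o s : A.

Lemma family_bracket_skew o s : even_super_skew (family_bracket o s).
Proof.
split.
- by move=> x c y z; coords; ring.
- by move=> y c x z; coords; ring.
- move=> p q [x f] [y g]; rewrite /homogeneous.
  case: p; case: q => /= -> ->; first [apply: row4P; split | apply: row2P; split];
  by rewrite ?(row4E, row2E, mxE); ring.
- move=> p q [x f] [y g]; rewrite /homogeneous.
  by case: p; case: q => /= -> ->; coords; ring.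
Qed.

Lemma family_bracket_lie o s : lie_superalgebra (family_bracket o s).
Proof.
split; first exact: family_bracket_skew.
move=> p q [x f] [y g] [z h]; rewrite /homogeneous.
case: p; case: q => /= -> ->; rewrite ?expr0 ?expr1 ?scale1r ?scaleN1r; coords; ring.
Qed.

End FamilyLie.

Section Form.
Variable A : comNzRingType.

(** For 2 o = 1 the coefficient -2 s is forced: e4 is central, so e4 is orthogonal to [e2, e3] = e4
    + 2 s e1, while e1 pairs with e4 to 1. *)
Definition family_form (s : A) (x y : svec A 4 2) : A :=
  x.1`_{0} * y.1`_{3} + x.1`_{3} * y.1`_{0} + x.1`_{1} * y.1`_{2}
  + x.1`_{2} * y.1`_{1} - 2 * s * x.1`_{3} * y.1`_{3}
  + (x.2`_{0} * y.2`_{1} - x.2`_{1} * y.2`_{0}).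

Lemma svec42_decomp (x : svec A 4 2) :
  x = x.1`_{0} *: (row4 1 0 0 0, 0) + x.1`_{1} *: (row4 0 1 0 0, 0)
    + x.1`_{2} *: (row4 0 0 1 0, 0) + x.1`_{3} *: (row4 0 0 0 1, 0)
    + x.2`_{0} *: (0, row2 1 0) + x.2`_{1} *: (0, row2 0 1).
Proof. by coords; ring. Qed.

Lemma family_metric_form (o s : A) : 2 * o = 1 ->
  metric_form (family_bracket o s) (family_form s).
Proof.
move=> o1; split.
- by move=> x c y z; rewrite /family_form /= !mxE /= /GRing.scale /=; ring.
- by move=> y c x z; rewrite /family_form /= !mxE /= /GRing.scale /=; ring.
- move=> p [x f] [y g]; rewrite /homogeneous /family_form.
  by case: p => /= -> ->; rewrite !mxE; ring.
- move=> p q [x f] [y g]; rewrite /homogeneous /family_form.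
  by case: p; case: q => /= -> ->; rewrite ?mxE; ring.
- move=> x y z.
  (* The e1 and e4 coordinates of the bracket are [s * Q] and [o * Q]. They meet the e4 coordinate
     of the other argument as s Q - 2 s o Q, the only part of the defect of invariance that does not
     cancel identically. *)
  pose Q (x y : svec A 4 2) := 2 * (x.1`_{1} * y.1`_{2} - x.1`_{2} * y.1`_{1})
    + (x.2`_{0} * y.2`_{1} + x.2`_{1} * y.2`_{0}).
  apply/eqP; rewrite -subr_eq0; apply/eqP.
  transitivity ((1 - 2 * o) * s * (Q x y * z.1`_{3} - x.1`_{3} * Q y z)).
    by rewrite /family_form /family_bracket /Q /= !(row4E, row2E); ring.
  by rewrite o1 subrr !mul0r.
move=> l; pose e k : svec A 4 2 :=
  (row4 (k == 0%N)%:R (k == 1%N)%:R (k == 2)%:R (k == 3)%:R,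
   row2 (k == 4)%:R (k == 5)%:R).
(* The dual basis for the pairs (e1, e4), (e2, e3), (e5, e6); the summand with 2 s compensates the
   value of the form at (e4, e4). *)
exists (row4 (l (e 3%N) + 2 * s * l (e 0%N)) (l (e 2%N)) (l (e 1%N)) (l (e 0%N)),
   row2 (l (e 5%N)) (- l (e 4%N))).
have row0 : row4 0 0 0 0 = 0 :> 'rV[A]_4 by apply: row4P; rewrite !row4E !mxE.
have row0' : row2 0 0 = 0 :> 'rV[A]_2 by apply: row2P; rewrite !row2E !mxE.
split.
  move=> y; rewrite [in RHS](svec42_decomp y) !linearD !linearZ /= /e /= row0 row0'.
  by rewrite /family_form /= !(row4E, row2E) /GRing.scale /=; ring.
move=> x xl.
rewrite -!xl /e /family_form /=; coords; ring.
Qed.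
End Form.

(** * Coefficients of power series; series extensions of brackets and maps *)

Section Series.
Variable K : comNzRingType.

Definition constant_coef (a : fps K) : K := coef_fps a 0%N.

Lemma constant_coef_is_zmod : zmod_morphism constant_coef. Proof. by []. Qed.
Lemma constant_coef_is_monoid : monoid_morphism constant_coef.
Proof. by split=> // a b; rewrite /constant_coef /= big_ord1. Qed.
HB.instance Definition _ := GRing.isZmodMorphism.Build _ _ constant_coef constant_coef_is_zmod.
HB.instance Definition _ := GRing.isMonoidMorphism.Build _ _ constant_coef constant_coef_is_monoid.

Lemma coef_fpsD (a b : fps K) k : coef_fps (a + b) k = coef_fps a k + coef_fps b k.
Proof. by []. Qed.
Lemma coef_fpsN (a : fps K) k : coef_fps (- a) k = - coef_fps a k.
Proof. by []. Qed.
Lemma coef_fps0 k : coef_fps (0 : fps K) k = 0.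
Proof. by []. Qed.
Lemma coef_fps1 k : coef_fps (1 : fps K) k = (k == 0%N)%:R.
Proof. by []. Qed.
Lemma coef_fps_sum I (r : seq I) P (F : I -> fps K) k :
  coef_fps (\sum_(i <- r | P i) F i) k = \sum_(i <- r | P i) coef_fps (F i) k.
Proof. exact: (big_morph (fun a => coef_fps a k)). Qed.
Lemma coef_fpsMn (a : fps K) n k : coef_fps (a *+ n) k = coef_fps a k *+ n.
Proof. by elim: n => // n IH; rewrite !mulrS coef_fpsD IH. Qed.

Definition const_fps (c : K) : fps K := Fps (fun k => if k == 0%N then c else 0).

Lemma coef_fpsM (a b : fps K) k : coef_fps (a * b) k =
  \sum_(i < k.+1) \sum_(j < k.+1 | (i + j == k)%N) coef_fps a i * coef_fps b j.
Proof.
apply: eq_bigr => i _; have ik : (i <= k)%N by rewrite -ltnS.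
rewrite (big_pred1 (inord (k - i))) ?inordK ?ltnS ?leq_subr // => j /=.
by rewrite -val_eqE /= inordK ?ltnS ?leq_subr // -[in RHS](eqn_add2l i) subnKC.
Qed.

(** The index set is that of [series_bracket], so that its coefficients can be recognised as those
    of products of three series. *)
Lemma coef_fpsM3 (a b c : fps K) k : coef_fps (a * b * c) k =
  \sum_(i < k.+1) \sum_(j < k.+1) \sum_(l < k.+1 | (i + j + l == k)%N)
    coef_fps a i * coef_fps b j * coef_fps c l.
Proof.
rewrite -mulrA; apply: eq_bigr => i _; have ik : (i <= k)%N by rewrite -ltnS.
rewrite coef_fpsM mulr_sumr.
under [RHS]eq_bigr => j _ do under eq_bigl => l do
  rewrite -addnA -[in X in (_ == X)%N](subnKC ik) eqn_add2l.
rewrite (big_ord_widen k.+1 (fun j => coef_fps a i *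
  \sum_(l < (k - i).+1 | (j + l == k - i)%N) coef_fps b j * coef_fps c l)); last first.
  by rewrite ltnS leq_subr.
rewrite (bigID (fun j : 'I_k.+1 => (j < (k - i).+1)%N) _ (fun j => \sum_(l < _ | _) _)) /=.
rewrite [X in _ = _ + X]big1 ?addr0; last first.
  move=> j; rewrite -leqNgt => hj; rewrite big1 // => l /eqP jl.
  by move: hj; rewrite -jl ltnNge leq_addr.
apply: eq_bigr => j _.
rewrite mulr_sumr (big_ord_widen_cond k.+1 (fun l => j + l == k - i)%N
  (fun l => coef_fps a i * (coef_fps b j * coef_fps c l))) /=; last first.
  by rewrite ltnS leq_subr.
apply: eq_big => [l|l _]; last by rewrite mulrA.
by case: eqP => //= <-; rewrite ltnS leq_addl.
Qed.
End Series.

Section Series.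
Variables K : numFieldType.

Lemma fst_row_sum (m n : nat) I (r : seq I) (P : pred I) (F : I -> svec K m n) j :
  (\sum_(i <- r | P i) F i).1 0 j = \sum_(i <- r | P i) (F i).1 0 j.
Proof. by apply: (big_morph (fun x : svec K m n => x.1 0 j)) => [x y|]; rewrite mxE. Qed.

Lemma snd_row_sum (m n : nat) I (r : seq I) (P : pred I) (F : I -> svec K m n) j :
  (\sum_(i <- r | P i) F i).2 0 j = \sum_(i <- r | P i) (F i).2 0 j.
Proof. by apply: (big_morph (fun x : svec K m n => x.2 0 j)) => [x y|]; rewrite mxE. Qed.

(** Each coordinate of a family bracket is a signed sum of products of three series: [L1] lists the
    positive terms and [L2] the negative ones. A coefficient 2 is encoded by listing a term
    twice. *)
Lemma coef_trilinear (L1 L2 : seq (fps K * fps K * fps K)) (e : fps K)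
    (F : nat -> nat -> nat -> K) k :
  e = \sum_(t <- L1) t.1.1 * t.1.2 * t.2 - \sum_(t <- L2) t.1.1 * t.1.2 * t.2 ->
  (forall i j l, F i j l =
    \sum_(t <- L1) coef_fps t.1.1 i * coef_fps t.1.2 j * coef_fps t.2 l -
    \sum_(t <- L2) coef_fps t.1.1 i * coef_fps t.1.2 j * coef_fps t.2 l) ->
  \sum_(i < k.+1) \sum_(j < k.+1) \sum_(l < k.+1 | (i + j + l == k)%N) F i j l =
  coef_fps e k.
Proof.
move=> -> FE; rewrite coef_fpsD coef_fpsN !coef_fps_sum.
under eq_bigr => i _ do under eq_bigr => j _ do
  ((under eq_bigr => l _ do rewrite FE); rewrite sumrB exchange_big [in X in _ - X]exchange_big).
under eq_bigr => i _ do
  (rewrite sumrB exchange_big [in X in _ - X]exchange_big).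
rewrite sumrB exchange_big [in X in _ - X]exchange_big /=.
by congr (_ - _); apply: eq_bigr => t _; rewrite -coef_fpsM3.
Qed.

Lemma series_bracket_fst (m n : nat)
    (phi : nat -> svec K m n -> svec K m n -> svec K m n) x y q :
  (series_bracket phi x y).1 0 q =
  Fps (fun k => \sum_(i < k.+1) \sum_(j < k.+1)
    \sum_(l < k.+1 | (i + j + l == k)%N)
    (phi i (svec_coef j x) (svec_coef l y)).1 0 q).
Proof.
rewrite mxE; apply: fpsP => k /=; rewrite fst_row_sum; apply: eq_bigr => i _.
by rewrite fst_row_sum; apply: eq_bigr => j _; rewrite fst_row_sum.
Qed.

Lemma series_bracket_snd (m n : nat)
    (phi : nat -> svec K m n -> svec K m n -> svec K m n) x y q :
  (series_bracket phi x y).2 0 q =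
  Fps (fun k => \sum_(i < k.+1) \sum_(j < k.+1)
    \sum_(l < k.+1 | (i + j + l == k)%N)
    (phi i (svec_coef j x) (svec_coef l y)).2 0 q).
Proof.
rewrite mxE; apply: fpsP => k /=; rewrite snd_row_sum; apply: eq_bigr => i _.
by rewrite snd_row_sum; apply: eq_bigr => j _; rewrite snd_row_sum.
Qed.

(** Linearity of the bracket in (o, s) is what lets the sequences of parameters be collected into
    two power series. *)
Lemma series_bracket_family (o s : nat -> K) (x y : svec (fps K) 4 2) :
  series_bracket (fun i => family_bracket (o i) (s i)) x y =
  family_bracket (Fps o) (Fps s) x y.
Proof.
set a := x.1; set f := x.2; set b := y.1; set g := y.2.
pose phi i j l := family_bracket (o i) (s i) (svec_coef j x) (svec_coef l y).
apply: injective_projections;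
  [apply: row4P; split | apply: row2P; split];
  rewrite (series_bracket_fst, series_bracket_snd) (row4E, row2E); apply: fpsP => k;
  cbn [coef_fps].
- refine (@coef_trilinear
    [:: (Fps s, a`_{1}, b`_{2}); (Fps s, a`_{1}, b`_{2});
        (Fps s, f`_{0}, g`_{1}); (Fps s, f`_{1}, g`_{0})]
    [:: (Fps s, a`_{2}, b`_{1}); (Fps s, a`_{2}, b`_{1})] _
    (fun i j l => (phi i j l).1`_{0}) k _ _);
  [|move=> i j l; rewrite /phi (row4E, row2E) !mxE];
  rewrite !big_cons !big_nil /= /a /b /f /g; ring.
- refine (@coef_trilinear
    [:: (Fps o, a`_{0}, b`_{1}); (Fps o, a`_{0}, b`_{1})]
    [:: (Fps o, a`_{1}, b`_{0}); (Fps o, a`_{1}, b`_{0}); (Fps s, f`_{0}, g`_{0})] _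
    (fun i j l => (phi i j l).1`_{1}) k _ _);
  [|move=> i j l; rewrite /phi (row4E, row2E) !mxE];
  rewrite !big_cons !big_nil /= /a /b /f /g; ring.
- refine (@coef_trilinear
    [:: (Fps o, f`_{1}, g`_{1}); (Fps o, f`_{1}, g`_{1});
        (Fps o, a`_{2}, b`_{0}); (Fps o, a`_{2}, b`_{0})]
    [:: (Fps o, a`_{0}, b`_{2}); (Fps o, a`_{0}, b`_{2})] _
    (fun i j l => (phi i j l).1`_{2}) k _ _);
  [|move=> i j l; rewrite /phi (row4E, row2E) !mxE];
  rewrite !big_cons !big_nil /= /a /b /f /g; ring.
- refine (@coef_trilinear
    [:: (Fps o, a`_{1}, b`_{2}); (Fps o, a`_{1}, b`_{2});
        (Fps o, f`_{0}, g`_{1}); (Fps o, f`_{1}, g`_{0})]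
    [:: (Fps o, a`_{2}, b`_{1}); (Fps o, a`_{2}, b`_{1})] _
    (fun i j l => (phi i j l).1`_{3}) k _ _);
  [|move=> i j l; rewrite /phi (row4E, row2E) !mxE];
  rewrite !big_cons !big_nil /= /a /b /f /g; ring.
- refine (@coef_trilinear
    [:: (Fps o, a`_{0}, g`_{0}); (Fps o, a`_{1}, g`_{1}); (Fps o, a`_{1}, g`_{1})]
    [:: (Fps o, f`_{0}, b`_{0}); (Fps o, f`_{1}, b`_{1}); (Fps o, f`_{1}, b`_{1})] _
    (fun i j l => (phi i j l).2`_{0}) k _ _);
  [|move=> i j l; rewrite /phi (row4E, row2E) !mxE];
  rewrite !big_cons !big_nil /= /a /b /f /g; ring.
- refine (@coef_trilinear
    [:: (Fps s, a`_{2}, g`_{0}); (Fps o, f`_{1}, b`_{0})]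
    [:: (Fps s, f`_{0}, b`_{2}); (Fps o, a`_{0}, g`_{1})] _
    (fun i j l => (phi i j l).2`_{1}) k _ _);
  [|move=> i j l; rewrite /phi (row4E, row2E) !mxE];
  rewrite !big_cons !big_nil /= /a /b /f /g; ring.
Qed.

(** This turns a change of basis over the power series ring into an equivalence: its psi_i are the
    coefficient matrices. *)
Lemma series_map_mulmx (m n : nat) (M : 'M[fps K]_m) (P : 'M[fps K]_n) x :
  series_map (fun i (x : svec K m n) =>
      (x.1 *m map_mx (fun c => coef_fps c i) M, x.2 *m map_mx (fun c => coef_fps c i) P)) x =
  (x.1 *m M, x.2 *m P).
Proof.
apply: injective_projections; apply/rowP => q; rewrite !mxE; apply: fpsP => k;
  cbn [coef_fps].
- transitivity (\sum_(i < k.+1) \sum_(j < k.+1 | (i + j == k)%N)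
     \sum_p coef_fps (x.1 0 p) j * coef_fps (M p q) i).
    rewrite fst_row_sum; apply: eq_bigr => i _; rewrite fst_row_sum.
    by apply: eq_bigr => j _; rewrite mxE; apply: eq_bigr => p _; rewrite !mxE.
  under eq_bigr => i _ do rewrite exchange_big.
  rewrite exchange_big coef_fps_sum; apply: eq_bigr => p _.
  rewrite mulrC coef_fpsM; apply: eq_bigr => i _.
  by apply: eq_bigr => j _; rewrite mulrC.
- transitivity (\sum_(i < k.+1) \sum_(j < k.+1 | (i + j == k)%N)
     \sum_p coef_fps (x.2 0 p) j * coef_fps (P p q) i).
    rewrite snd_row_sum; apply: eq_bigr => i _; rewrite snd_row_sum.
    by apply: eq_bigr => j _; rewrite mxE; apply: eq_bigr => p _; rewrite !mxE.
  under eq_bigr => i _ do rewrite exchange_big.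
  rewrite exchange_big coef_fps_sum; apply: eq_bigr => p _.
  rewrite mulrC coef_fpsM; apply: eq_bigr => i _.
  by apply: eq_bigr => j _; rewrite mulrC.
Qed.
End Series.

(** * Lifting bases over a local ring *)

Section LocalRing.
Variables (A : comNzRingType) (K : numFieldType) (ev : {rmorphism A -> K}).
Hypothesis ev_unit : forall c, ev c != 0 -> exists c', c' * c = 1.

Lemma map_row4 a b c d :
  map_mx ev (row4 a b c d) = row4 (ev a) (ev b) (ev c) (ev d).
Proof. by apply: row4P; rewrite !mxE !inordK. Qed.

Lemma map_row2 a b : map_mx ev (row2 a b) = row2 (ev a) (ev b).
Proof. by apply: row2P; rewrite !mxE !inordK. Qed.

(** The determinant reduces to 1, hence is a unit, and the adjugate divided by it is a two-sided
    inverse. *)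
Lemma local_mx_inverse n (M : 'M[A]_n) : map_mx ev M = 1%:M ->
  exists2 M', M' *m M = 1%:M & M *m M' = 1%:M.
Proof.
move=> M1; have /ev_unit [d dM] : ev (\det M) != 0.
  by rewrite -det_map_mx M1 det1 oner_eq0.
exists (d *: \adj M).
  by rewrite -scalemxAl mul_adj_mx scale_scalar_mx dM.
by rewrite -scalemxAr mul_mx_adj scale_scalar_mx dM.
Qed.

Definition rows4 (x0 x1 x2 x3 : 'rV[A]_4) : 'M[A]_4 :=
  \matrix_(i < 4) [:: x0; x1; x2; x3]`_i.
Definition rows2 (x0 x1 : 'rV[A]_2) : 'M[A]_2 := \matrix_(i < 2) [:: x0; x1]`_i.

Lemma mul_rows4 c x0 x1 x2 x3 : c *m rows4 x0 x1 x2 x3 =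
  c`_{0} *: x0 + c`_{1} *: x1 + c`_{2} *: x2 + c`_{3} *: x3.
Proof.
apply/rowP => j; rewrite !mxE.
rewrite (eq_bigr (fun i : 'I_4 => c`_{i} * [:: x0; x1; x2; x3]`_i 0 j)).
  by rewrite !big_ord_recl big_ord0 addr0 /= !addrA.
by move=> i _; rewrite !mxE inord_val.
Qed.

Lemma mul_rows2 c x0 x1 : c *m rows2 x0 x1 = c`_{0} *: x0 + c`_{1} *: x1.
Proof.
apply/rowP => j; rewrite !mxE.
rewrite (eq_bigr (fun i : 'I_2 => c`_{i} * [:: x0; x1]`_i 0 j)).
  by rewrite !big_ord_recl big_ord0 addr0 /=.
by move=> i _; rewrite !mxE inord_val.
Qed.

Definition lifts4 (x0 x1 x2 x3 : 'rV[A]_4) :=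
  [/\ map_mx ev x0 = row4 1 0 0 0, map_mx ev x1 = row4 0 1 0 0,
      map_mx ev x2 = row4 0 0 1 0 & map_mx ev x3 = row4 0 0 0 1].
Definition lifts2 (x0 x1 : 'rV[A]_2) :=
  map_mx ev x0 = row2 1 0 /\ map_mx ev x1 = row2 0 1.

Lemma map_rows4 x0 x1 x2 x3 : lifts4 x0 x1 x2 x3 ->
  map_mx ev (rows4 x0 x1 x2 x3) = 1%:M.
Proof.
move=> [/rowP h0 /rowP h1 /rowP h2 /rowP h3]; apply/matrixP => i j.
rewrite !mxE; case: i => [[|[|[|[|//]]]]] ilt /=;
  [move: (h0 j)|move: (h1 j)|move: (h2 j)|move: (h3 j)]; rewrite !mxE => ->;
  by case: j => [[|[|[|[|//]]]]].
Qed.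

Lemma map_rows2 x0 x1 : lifts2 x0 x1 -> map_mx ev (rows2 x0 x1) = 1%:M.
Proof.
move=> [/rowP h0 /rowP h1]; apply/matrixP => i j.
rewrite !mxE; case: i => [[|[|//]]] ilt /=;
  [move: (h0 j)|move: (h1 j)]; rewrite !mxE => ->;
  by case: j => [[|[|//]]].
Qed.

(** Nakayama in matrix form: lifts of the standard basis are the rows of an invertible matrix, so
    they span and, by the next lemma, are free. *)
Lemma lifts4_span x0 x1 x2 x3 x : lifts4 x0 x1 x2 x3 ->
  exists c0 c1 c2 c3, x = c0 *: x0 + c1 *: x1 + c2 *: x2 + c3 *: x3.
Proof.
move=> /map_rows4/local_mx_inverse[M' M'M _]; set c := x *m M'.
exists c`_{0}, c`_{1}, c`_{2}, c`_{3}.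
by rewrite -mul_rows4 /c -mulmxA M'M mulmx1.
Qed.

Lemma lifts4_free x0 x1 x2 x3 c0 c1 c2 c3 : lifts4 x0 x1 x2 x3 ->
  c0 *: x0 + c1 *: x1 + c2 *: x2 + c3 *: x3 = 0 ->
  [/\ c0 = 0, c1 = 0, c2 = 0 & c3 = 0].
Proof.
move=> /map_rows4/local_mx_inverse[M' _ MM'] c_eq0.
have : row4 c0 c1 c2 c3 *m rows4 x0 x1 x2 x3 = 0 by rewrite mul_rows4 !row4E.
move=> /(congr1 (mulmx^~ M')); rewrite -mulmxA MM' mulmx1 mul0mx => /rowP c0E.
by split; [have := c0E (inord 0)|have := c0E (inord 1)|have := c0E (inord 2)
          |have := c0E (inord 3)]; rewrite row4E mxE.
Qed.

Lemma lifts2_span x0 x1 x : lifts2 x0 x1 -> exists c0 c1, x = c0 *: x0 + c1 *: x1.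
Proof.
move=> /map_rows2/local_mx_inverse[M' M'M _]; set c := x *m M'.
by exists c`_{0}, c`_{1}; rewrite -mul_rows2 /c -mulmxA M'M mulmx1.
Qed.

Lemma lifts2_free x0 x1 c0 c1 : lifts2 x0 x1 ->
  c0 *: x0 + c1 *: x1 = 0 -> c0 = 0 /\ c1 = 0.
Proof.
move=> /map_rows2/local_mx_inverse[M' _ MM'] c_eq0.
have : row2 c0 c1 *m rows2 x0 x1 = 0 by rewrite mul_rows2 !row2E.
move=> /(congr1 (mulmx^~ M')); rewrite -mulmxA MM' mulmx1 mul0mx => /rowP c0E.
by split; [have := c0E (inord 0)|have := c0E (inord 1)]; rewrite row2E mxE.
Qed.
End LocalRing.

(** * Normal form: [a], [r], [q] are the components of the bracket by parity, [b] and [w] those of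
    the form *)

Section NormalForm.
Variables (A : comNzRingType) (K : numFieldType) (ev : {rmorphism A -> K}).
Hypothesis ev_unit : forall c, ev c != 0 -> exists c', c' * c = 1.

Variables (a : 'rV[A]_4 -> 'rV[A]_4 -> 'rV[A]_4).
Variables (r : 'rV[A]_4 -> 'rV[A]_2 -> 'rV[A]_2).
Variables (q : 'rV[A]_2 -> 'rV[A]_2 -> 'rV[A]_4).
Hypothesis aP : forall x, linear (a x).
Hypothesis aC : forall x y, a y x = - a x y.
Hypothesis aJ : forall x y z, a x (a y z) = a (a x y) z + a y (a x z).
Hypothesis rPl : forall f, linear (r^~ f).
Hypothesis rPr : forall x, linear (r x).
Hypothesis rM : forall x y f, r (a x y) f = r x (r y f) - r y (r x f).
Hypothesis qP : forall f, linear (q f).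
Hypothesis qC : forall f g, q g f = q f g.
Hypothesis qM : forall x f g, a x (q f g) = q (r x f) g + q f (r x g).
Hypothesis qJ : forall f, r (q f f) f = 0.

Variables (b : 'rV[A]_4 -> 'rV[A]_4 -> A) (w : 'rV[A]_2 -> 'rV[A]_2 -> A).
Hypothesis bP : forall x, linear (b x : 'rV[A]_4 -> A^o).
Hypothesis bC : forall x y, b x y = b y x.
Hypothesis bI : forall x y z, b (a x y) z = b x (a y z).
Hypothesis bN : forall x, (forall y, b x y = 0) -> x = 0.
Hypothesis wP : forall f, linear (w f : 'rV[A]_2 -> A^o).
Hypothesis wC : forall f g, w f g = - w g f.
Hypothesis wI : forall x f g, w (r x f) g = - w f (r x g).
Hypothesis wN : forall f, (forall g, w f g = 0) -> f = 0.

Let a0 (x y : 'rV[K]_4) := (family_bracket 2^-1 0 (x, 0) (y, 0)).1.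
Let r0 (x : 'rV[K]_4) f := (family_bracket 2^-1 0 (x, 0) (0, f)).2.
Let q0 (f g : 'rV[K]_2) := (family_bracket 2^-1 0 (0, f) (0, g)).1.
Hypothesis aE : forall x y, map_mx ev (a x y) = a0 (map_mx ev x) (map_mx ev y).
Hypothesis rE : forall x f, map_mx ev (r x f) = r0 (map_mx ev x) (map_mx ev f).
Hypothesis qE : forall f g, map_mx ev (q f g) = q0 (map_mx ev f) (map_mx ev g).

Let aDr x y z : a x (y + z) = a x y + a x z.
Proof. by have := aP x 1 y z; rewrite !scale1r. Qed.
Let a0r x : a x 0 = 0.
Proof. by apply: (@addIr _ (a x 0)); rewrite -aDr !add0r. Qed.
Let aZr c x y : a x (c *: y) = c *: a x y.
Proof. by have := aP x c y 0; rewrite a0r !addr0. Qed.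
Let aDl x y z : a (x + y) z = a x z + a y z.
Proof. by rewrite aC aDr opprD -!(aC z). Qed.
Let aZl c x z : a (c *: x) z = c *: a x z.
Proof. by rewrite aC aZr -scalerN -aC. Qed.
Let aNr x y : a x (- y) = - a x y.
Proof. by rewrite -!scaleN1r aZr. Qed.
Let aNl x y : a (- x) y = - a x y.
Proof. by rewrite -!scaleN1r aZl. Qed.

Let rDr x f g : r x (f + g) = r x f + r x g.
Proof. by have := rPr x 1 f g; rewrite !scale1r. Qed.
Let r0r x : r x 0 = 0.
Proof. by apply: (@addIr _ (r x 0)); rewrite -rDr !add0r. Qed.
Let rZr c x f : r x (c *: f) = c *: r x f.
Proof. by have := rPr x c f 0; rewrite r0r !addr0. Qed.
Let rNr x f : r x (- f) = - r x f.
Proof. by rewrite -!scaleN1r rZr. Qed.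
Let rDl x y f : r (x + y) f = r x f + r y f.
Proof. by have := rPl f 1 x y; rewrite !scale1r. Qed.
Let r0l f : r 0 f = 0.
Proof. by apply: (@addIr _ (r 0 f)); rewrite -rDl !add0r. Qed.
Let rZl c x f : r (c *: x) f = c *: r x f.
Proof. by have := rPl f c x 0; rewrite r0l !addr0. Qed.
Let rNl x f : r (- x) f = - r x f.
Proof. by rewrite -!scaleN1r rZl. Qed.

Let qDr x f g : q x (f + g) = q x f + q x g.
Proof. by have := qP x 1 f g; rewrite !scale1r. Qed.
Let q0r x : q x 0 = 0.
Proof. by apply: (@addIr _ (q x 0)); rewrite -qDr !add0r. Qed.
Let qZr c x f : q x (c *: f) = c *: q x f.
Proof. by have := qP x c f 0; rewrite q0r !addr0. Qed.
Let qDl f g x : q (f + g) x = q f x + q g x.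
Proof. by rewrite qC qDr !(qC x). Qed.
Let qZl c f x : q (c *: f) x = c *: q f x.
Proof. by rewrite qC qZr qC. Qed.

Let bDr x y z : b x (y + z) = b x y + b x z.
Proof. by have := bP x 1 y z; rewrite !scale1r. Qed.
Let b0r x : b x 0 = 0.
Proof. by apply: (@addIr _ (b x 0)); rewrite -bDr !add0r. Qed.
Let bZr c x y : b x (c *: y) = c * b x y.
Proof. by have := bP x c y 0; rewrite b0r !addr0. Qed.
Let bNr x y : b x (- y) = - b x y.
Proof. by rewrite -scaleN1r bZr mulN1r. Qed.
Let bDl x y z : b (x + y) z = b x z + b y z.
Proof. by rewrite bC bDr !(bC z). Qed.
Let bZl c x z : b (c *: x) z = c * b x z.
Proof. by rewrite bC bZr bC. Qed.
Let bNl x y : b (- x) y = - b x y.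
Proof. by rewrite bC bNr bC. Qed.

Let wDr x y z : w x (y + z) = w x y + w x z.
Proof. by have := wP x 1 y z; rewrite !scale1r. Qed.
Let w0r x : w x 0 = 0.
Proof. by apply: (@addIr _ (w x 0)); rewrite -wDr !add0r. Qed.
Let wZr c x y : w x (c *: y) = c * w x y.
Proof. by have := wP x c y 0; rewrite w0r !addr0. Qed.
Let wDl x y z : w (x + y) z = w x z + w y z.
Proof. by rewrite wC wDr opprD -!(wC _ z). Qed.
Let wZl c x z : w (c *: x) z = c * w x z.
Proof. by rewrite wC wZr -mulrN -wC. Qed.

Let ev_nat n : ev n%:R = n%:R. Proof. exact: rmorph_nat. Qed.

Let half : exists h : A, 2 * h = 1.
Proof.
have /ev_unit[h h2] : ev 2 != 0 by rewrite ev_nat pnatr_eq0.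
by exists h; rewrite mulrC.
Qed.

Let double_eq0 (T : lmodType A) (x : T) : x + x = 0 -> x = 0.
Proof.
by case: half => h h2 x0; rewrite -[x]scale1r -h2 mulrC -scalerA scaler_nat mulr2n x0 scaler0.
Qed.

Let half2 : 2 * 2^-1 = 1 :> K.
Proof. by rewrite mulfV // pnatr_eq0. Qed.

Lemma a0E x0 x1 x2 x3 y0 y1 y2 y3 : a0 (row4 x0 x1 x2 x3) (row4 y0 y1 y2 y3) =
  row4 0 (x0 * y1 - x1 * y0) (x2 * y0 - x0 * y2) (x1 * y2 - x2 * y1).
Proof.
by apply: row4P; rewrite /a0 /= !row4E !mxE half2; split; ring.
Qed.

Lemma r0E x0 x1 x2 x3 f0 f1 : r0 (row4 x0 x1 x2 x3) (row2 f0 f1) =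
  row2 (2^-1 * (x0 * f0) + x1 * f1) (- (2^-1 * (x0 * f1))).
Proof.
by apply: row2P; rewrite /r0 /= !(row2E, row4E) !mxE half2; split; ring.
Qed.

Lemma q0E f0 f1 g0 g1 : q0 (row2 f0 f1) (row2 g0 g1) =
  row4 0 0 (f1 * g1) (2^-1 * (f0 * g1 + f1 * g0)).
Proof.
by apply: row4P; rewrite /q0 /= !(row2E, row4E) !mxE half2; split; ring.
Qed.

Let e1 : 'rV[A]_4 := row4 1 0 0 0.
Let e2 : 'rV[A]_4 := row4 0 1 0 0.
Let e3 : 'rV[A]_4 := row4 0 0 1 0.
Let e4 : 'rV[A]_4 := row4 0 0 0 1.
Let f5 : 'rV[A]_2 := row2 1 0.
Let f6 : 'rV[A]_2 := row2 0 1.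

Let lifts4_e : lifts4 ev e1 e2 e3 e4.
Proof. by split; rewrite map_row4 rmorph0 rmorph1. Qed.
Let lifts2_e : lifts2 ev f5 f6.
Proof. by split; rewrite map_row2 rmorph0 rmorph1. Qed.

Let row2_decomp (f : 'rV[A]_2) : f = f`_{0} *: f5 + f`_{1} *: f6.
Proof. by apply: row2P; rewrite !mxE !inordK //=; split; ring. Qed.

Let w_nondeg F5 F6 f : lifts2 ev F5 F6 -> w f F5 = 0 -> w f F6 = 0 -> f = 0.
Proof.
move=> l w5 w6; apply: wN => g; have [c0 [c1 ->]] := lifts2_span ev_unit g l.
by rewrite wDr !wZr w5 w6 !mulr0 addr0.
Qed.

Lemma w_alt f : w f f = 0.
Proof. by apply: (@double_eq0 A^o); rewrite {1}wC addNr. Qed.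

(** [w] is alternating and non-degenerate in rank 2, so [r x] lies in sp(2) = sl(2). The trace
    multiplies [w f5 f6] to 0, and a scalar doing so makes a multiple of [f5] orthogonal to
    everything. *)
Let trace_r x : (r x f5)`_{0} + (r x f6)`_{1} = 0.
Proof.
set c := _ + _.
have c56 : c * w f5 f6 = 0.
  have := wI x f5 f6; rewrite [r x f5]row2_decomp [r x f6]row2_decomp.
  rewrite wDl wDr !wZl !wZr !w_alt !mulr0 addr0 add0r => h.
  by rewrite mulrDl h addNr.
have : c *: f5 = 0 by apply: (w_nondeg lifts2_e); rewrite wZl ?w_alt ?mulr0.
by move/rowP => /(_ (inord 0)); rewrite !mxE inordK // mulr1.
Qed.

(** The action of e1 is traceless and reduces to diag(1/2, -1/2). Subtracting a multiple of e2 makes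
    it triangular with [f6] as eigenvector, and the eigenvalues are then separated by a unit. *)
Lemma odd_eigenbasis : exists E1 F5 h, [/\ map_mx ev E1 = row4 1 0 0 0, lifts2 ev F5 f6, 2 * h = 1,
  r E1 F5 = h *: F5 & r E1 f6 = - (h *: f6)].
Proof.
have [e1E e2E _ _] := lifts4_e; have [f5E f6E] := lifts2_e.
have r16 : map_mx ev (r e1 f6) = row2 0 (- 2^-1).
  by rewrite rE e1E f6E r0E; congr row2; ring.
have r26 : map_mx ev (r e2 f6) = row2 1 0.
  by rewrite rE e2E f6E r0E; congr row2; ring.
have [c' c'E] : exists c', c' * (r e2 f6)`_{0} = 1.
  apply: ev_unit; have /rowP/(_ (inord 0)) := r26.
  by rewrite row2E mxE => ->; rewrite oner_eq0.
(* The multiple of e2 that cancels the [f5] coordinate of [r e1 f6]; it is available because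
   [r e2 f6] has a unit there. *)
pose u := e1 - ((r e1 f6)`_{0} * c') *: e2.
have ev_b : ev (r e1 f6)`_{0} = 0.
  by have /rowP/(_ (inord 0)) := r16; rewrite row2E mxE.
have uE : map_mx ev u = row4 1 0 0 0.
  by rewrite map_mxB map_mxZ e1E rmorphM ev_b mul0r scale0r subr0.
have u6 : (r u f6)`_{0} = 0.
  rewrite rDl rNl rZl !mxE -mulrA c'E; ring.
set l := (r u f5)`_{0}.
have lE : ev l = 2^-1.
  have : map_mx ev (r u f5) = row2 2^-1 0.
    by rewrite rE uE f5E r0E; congr row2; ring.
  by move/rowP/(_ (inord 0)); rewrite row2E mxE.
have ru6 : r u f6 = - (l *: f6).
  rewrite [LHS]row2_decomp u6 scale0r add0r -scaleNr; congr (_ *: _).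
  by apply/eqP; rewrite -addr_eq0 addrC trace_r.
have [m mE] : exists m, m * (2 * l) = 1.
  by apply: ev_unit; rewrite rmorphM lE ev_nat half2 oner_eq0.
have ev_m : ev m = 1.
  by move/(congr1 ev): mE; rewrite !rmorphM lE ev_nat half2 mulr1 rmorph1.
(* If [r u f5] is l f5 + d f6, then f5 + c f6 is an eigenvector for l exactly when 2 l c = d, and
   [m] inverts 2 l. Scaling [u] by [m] also turns l into 1/2. *)
pose c := m * (r u f5)`_{1}.
have ev_c : ev c = 0.
  have : map_mx ev (r u f5) = row2 2^-1 0.
    by rewrite rE uE f5E r0E; congr row2; ring.
  by move/rowP/(_ (inord 1)); rewrite row2E mxE rmorphM => ->; rewrite mulr0.
have h2 : 2 * (m * l) = 1 by rewrite mulrCA mE.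
exists (m *: u), (f5 + c *: f6), (m * l); split=> //.
- by rewrite map_mxZ ev_m scale1r.
- by split=> //; rewrite map_mxD map_mxZ ev_c scale0r addr0.
- rewrite rZl rDr rZr ru6 [r u f5]row2_decomp -/l.
  apply/rowP => j; rewrite !mxE.
  set x := [:: _; _]`_j; set y := [:: _; _]`_j.
  rewrite /c; apply/eqP; rewrite -subr_eq0; apply/eqP.
  transitivity ((1 - 2 * (m * l)) * m * (r u f5)`_{1} * y); first by ring.
  by rewrite h2 subrr !mul0r.
- by rewrite rZl ru6 scalerN scalerA.
Qed.

Section Weights.
Variables (E1 : 'rV[A]_4) (F5 : 'rV[A]_2) (h : A).
Hypotheses (E1E : map_mx ev E1 = row4 1 0 0 0) (F5E : lifts2 ev F5 f6).
Hypotheses (h2 : 2 * h = 1) (r15 : r E1 F5 = h *: F5) (r16 : r E1 f6 = - (h *: f6)).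

Let a11 x : a x x = 0.
Proof. by apply: (@double_eq0 'rV[A]_4); rewrite [X in X + _]aC addNr. Qed.

Let ev_h : ev h = 2^-1.
Proof.
move/(congr1 ev): h2; rewrite rmorphM ev_nat rmorph1 => h2'.
by apply: (@mulfI _ 2); rewrite ?pnatr_eq0 // h2' half2.
Qed.

Let weight_coord v : exists c0 c1, v = c0 *: F5 + c1 *: f6 /\
  r E1 v = (h * c0) *: F5 + (- (h * c1)) *: f6.
Proof.
have [c0 [c1 vE]] := lifts2_span ev_unit v F5E; exists c0, c1; split=> //.
by rewrite vE rDr !rZr r15 r16 scalerN !scalerA scaleNr !(mulrC h).
Qed.

Let h_cancel c : h * c + h * c = 0 -> c = 0.
Proof. by move=> hc; rewrite -[c]mul1r -h2 -mulrA mulrDl !mul1r. Qed.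

Let eq0_sub n (u v t : 'rV[A]_n) : u = v -> t = u - v -> t = 0.
Proof. by move=> ->; rewrite subrr. Qed.

(** The odd weights h and -h differ by the unit 2 h = 1, so each weight space is a line. In the same
    way 3/2 differs from them by the units 1 and 2, so it is not a weight. *)
Let weight_half v : r E1 v = h *: v -> exists c, v = c *: F5.
Proof.
have [c0 [c1 [vE ->]]] := weight_coord v; rewrite vE => eq_v.
have [] := @lifts2_free _ _ _ ev_unit _ _ 0 (h * c1 + h * c1) F5E.
  by apply: (eq0_sub (esym eq_v)); apply/rowP => j; rewrite !mxE; ring.
by move=> _ /h_cancel ->; exists c0; rewrite scale0r addr0.
Qed.

Let weight_Nhalf v : r E1 v = - (h *: v) -> exists c, v = c *: f6.
Proof.
have [c0 [c1 [vE ->]]] := weight_coord v; rewrite vE => eq_v.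
have [] := @lifts2_free _ _ _ ev_unit _ _ (h * c0 + h * c0) 0 F5E.
  by apply: (eq0_sub eq_v); apply/rowP => j; rewrite !mxE; ring.
by move=> /h_cancel -> _; exists c1; rewrite scale0r add0r.
Qed.

Let weight_3half v : r E1 v = v + h *: v -> v = 0.
Proof.
have [c0 [c1 [vE ->]]] := weight_coord v; rewrite vE => eq_v.
have [] := @lifts2_free _ _ _ ev_unit _ _ c0 (c1 + (h * c1 + h * c1)) F5E.
  by apply: (eq0_sub (esym eq_v)); apply/rowP => j; rewrite !mxE; ring.
by rewrite -mulr2n -mulr_natl mulrA h2 mul1r => -> /(@double_eq0 A^o) ->; rewrite !scale0r addr0.
Qed.

Let E3 := q f6 f6.

Let E3E : map_mx ev E3 = row4 0 0 1 0.
Proof. by rewrite qE (proj2 F5E) q0E; congr row4; ring. Qed.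

Let a13 : a E1 E3 = - E3.
Proof.
rewrite qM r16 -scaleNr qZl qZr -/E3 -scalerDl -opprD -mulr2n -mulr_natl h2.
by rewrite scaleN1r.
Qed.

Let D_skew x y : b (a E1 x) y = - b x (a E1 y).
Proof. by rewrite aC bNl bI. Qed.

(* [b (N x) y] with N = D^3 - D is an alternating form killed by E1 and E3 and
   invariant under D = ad E1; on the remaining plane it is a multiple of the
   area form, which D scales by its trace, a unit as the reduction has trace 1. *)
Let D_cube x : a E1 (a E1 (a E1 x)) = a E1 x.
Proof.
pose N x := a E1 (a E1 (a E1 x)) - a E1 x; pose om x y := b (N x) y.
have ND y z : N (y + z) = N y + N z.
  by rewrite /N !aDr; apply/rowP => j; rewrite !mxE; ring.
have NZ c y : N (c *: y) = c *: N y by rewrite /N !aZr scalerBr.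
have N1 : N E1 = 0 by rewrite /N !a11 !a0r subr0.
have N3 : N E3 = 0 by rewrite /N a13 aNr a13 !opprK a13 addNr.
have omDl y z t : om (y + z) t = om y t + om z t by rewrite /om ND bDl.
have omDr y z t : om y (z + t) = om y z + om y t by rewrite /om bDr.
have omZl c y z : om (c *: y) z = c * om y z by rewrite /om NZ bZl.
have omZr c y z : om y (c *: z) = c * om y z by rewrite /om bZr.
have om_skew y z : om y z = - om z y.
  have -> : om y z = - b y (N z) by rewrite /om /N bDl bNl bDr bNr !D_skew; ring.
  by rewrite bC.
have om11 y : om y y = 0.
  by apply: (@double_eq0 A^o); rewrite [X in X + _]om_skew addNr.
have om1 y : om E1 y = 0 by rewrite /om N1 bC b0r.
have om3 y : om E3 y = 0 by rewrite /om N3 bC b0r.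
have om1r y : om y E1 = 0 by rewrite om_skew om1 oppr0.
have om3r y : om y E3 = 0 by rewrite om_skew om3 oppr0.
have om_inv y z : om (a E1 y) z + om y (a E1 z) = 0.
  rewrite /om; have -> : N (a E1 y) = a E1 (N y) by rewrite /N aDr aNr.
  by rewrite D_skew addNr.
have L : lifts4 ev E1 e2 E3 e4.
  by have [_ ? _ ?] := lifts4_e; split.
have om24 : om e2 e4 = 0.
  have [c0 [c1 [c2 [c3 e2E]]]] := lifts4_span ev_unit (a E1 e2) L.
  have [d0 [d1 [d2 [d3 e4E]]]] := lifts4_span ev_unit (a E1 e4) L.
  have [_ ev2 _ ev4] := lifts4_e.
  have /ev_unit[k kE] : ev (c1 + d3) != 0.
    have ev_c1 : ev c1 = 1.
      move/(congr1 (map_mx ev)): e2E; rewrite aE E1E ev2 a0E !map_mxD !map_mxZ.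
      rewrite E1E ev2 E3E ev4 => /rowP/(_ (inord 1)).
      by rewrite !mxE !inordK //= !(mul1r, mulr0, mulr1, add0r, addr0, subr0) => <-.
    have ev_d3 : ev d3 = 0.
      move/(congr1 (map_mx ev)): e4E; rewrite aE E1E ev4 a0E !map_mxD !map_mxZ.
      rewrite E1E ev2 E3E ev4 => /rowP/(_ (inord 3)).
      by rewrite !mxE !inordK //= !(mul0r, mulr0, mulr1, add0r, oppr0, subr0) => <-.
    by rewrite rmorphD ev_c1 ev_d3 addr0 oner_eq0.
  have := om_inv e2 e4; rewrite e2E e4E !omDl !omDr !omZl !omZr !om1 !om3 !om11.
  rewrite om1r om3r !mulr0 !(add0r, addr0) -mulrDl => om_eq0.
  by rewrite -[LHS]mul1r -kE -mulrA om_eq0 mulr0.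
apply/eqP; rewrite -subr_eq0; apply/eqP; apply: bN => y.
rewrite -/(N x) -/(om x y).
have [c0 [c1 [c2 [c3 ->]]]] := lifts4_span ev_unit x L.
have [d0 [d1 [d2 [d3 ->]]]] := lifts4_span ev_unit y L.
rewrite !omDl !omDr !omZl !omZr !om1 !om3 !om11 !om1r !om3r (om_skew e4) om24.
ring.
Qed.

(** Weights confine each bracket to a line or a plane; the Jacobi identity and the form then fix the
    coefficients, all except s. *)
Lemma normal_form_brackets : exists E2 E4 s,
  [/\ lifts4 ev E1 E2 E3 E4, ev s = 0,
    [/\ a E1 E2 = E2, a E1 E3 = - E3, a E1 E4 = 0, a E2 E3 = E4 + s *: E1 &
      a E2 E4 = 0 /\ a E3 E4 = 0],
    [/\ r E2 F5 = 0, r E2 f6 = F5, r E3 F5 = (h * s) *: f6, r E3 f6 = 0 &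
      r E4 F5 = 0 /\ r E4 f6 = 0]
  & q F5 F5 = - ((h * s) *: E2) /\ q F5 f6 = h *: (E4 + s *: E1)].
Proof.
have [F5E' f6E] := F5E; have [_ ev2 _ ev4] := lifts4_e.
(* By D^3 = D the image of D^2 + D has weight 1; the factor 1/2 makes the vector reduce to e2. *)
pose E2' := h *: (a E1 (a E1 e2) + a E1 e2).
have a12' : a E1 E2' = E2' by rewrite /E2' aZr aDr D_cube addrC.
have E2'E : map_mx ev E2' = row4 0 1 0 0.
  rewrite /E2' map_mxZ map_mxD !aE E1E ev2 !a0E ev_h.
  apply: row4P; rewrite !mxE !inordK //=; split; rewrite ?(mul0r, mulr0, add0r, subr0, oppr0) //.
  by rewrite !mulr1 -mulr2n mulrC half2.
have rcomm x f : r E1 (r x f) = r (a E1 x) f + r x (r E1 f).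
  by rewrite rM subrK.
(* This vector has weight 1 - 1/2 = 1/2. Its coefficient [u] reduces to 1 and is normalised away in
   [E2]. *)
have [u uE] : exists u, r E2' f6 = u *: F5.
  apply: weight_half; rewrite rcomm a12' r16 rNr rZr -[X in X + _ = _]scale1r -h2.
  by apply/rowP => j; rewrite !mxE; ring.
have ev_u : ev u = 1.
  have : map_mx ev (r E2' f6) = row2 1 0.
    by rewrite rE E2'E f6E r0E; congr row2; ring.
  rewrite uE map_mxZ F5E' => /rowP/(_ (inord 0)).
  by rewrite !mxE inordK //= mulr1.
have [v vE] : exists v, v * u = 1 by apply: ev_unit; rewrite ev_u oner_eq0.
have ev_v : ev v = 1 by move/(congr1 ev): vE; rewrite rmorphM ev_u rmorph1 mulr1.
pose E2 := v *: E2'.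
have E2E : map_mx ev E2 = row4 0 1 0 0 by rewrite map_mxZ ev_v scale1r.
have a12 : a E1 E2 = E2 by rewrite aZr a12'.
have r26 : r E2 f6 = F5 by rewrite rZl uE scalerA vE scale1r.
clearbody E2.
have r25 : r E2 F5 = 0 by apply: weight_3half; rewrite rcomm a12 r15 rZr.
pose H := a E2 E3.
have HE : map_mx ev H = row4 0 0 0 1.
  by rewrite /H aE E2E E3E a0E; congr row4; ring.
have a1H : a E1 H = 0 by rewrite /H aJ a12 a13 aNr subrr.
have LH : lifts4 ev E1 E2 E3 H by split.
(* In the basis E1, E2, E3, H of weights 0, 1, -1, 0, only multiples of E2 have weight 1. *)
have [s aH2] : exists s, a H E2 = s *: E2.
  have : a E1 (a H E2) = a H E2 by rewrite aJ a1H a12 aC a0r oppr0 add0r.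
  have [c0 [c1 [c2 [c3 ->]]]] := lifts4_span ev_unit (a H E2) LH.
  rewrite !aDr !aZr a11 a12 a13 a1H => eq_c.
  have [] := @lifts4_free _ _ _ ev_unit _ _ _ _ c0 0 (c2 + c2) c3 LH.
    by apply: (eq0_sub (esym eq_c)); apply/rowP => j; rewrite !mxE; ring.
  move=> -> _ /(@double_eq0 A^o) -> ->.
  by exists c1; rewrite !scale0r !addr0 add0r.
have ev_s : ev s = 0.
  move/(congr1 (map_mx ev)): aH2; rewrite aE HE E2E a0E map_mxZ E2E.
  by move/rowP/(_ (inord 1)); rewrite !mxE !inordK //= !mulr1 => <-; ring.
(* H and s E1 act on E2 by the same scalar s and both commute with E1, so the difference commutes
   with E1 and E2. *)
pose E4 := H - s *: E1.
have HE4 : H = E4 + s *: E1 by rewrite subrK.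
have a14 : a E1 E4 = 0 by rewrite aDr aNr aZr a11 a1H scaler0 subr0.
have a24 : a E2 E4 = 0.
  by rewrite aC aDl aNl aZl aH2 a12 subrr oppr0.
have E4E : map_mx ev E4 = row4 0 0 0 1.
  by rewrite map_mxB map_mxZ ev_s scale0r subr0.
have L : lifts4 ev E1 E2 E3 E4 by split.
clearbody E4.
(* [E4, E3] is orthogonal to the whole basis. By invariance, pairing it with E2, E3 or E4 leads to a
   vanishing bracket, and pairing it with E1 gives b(E4, E3), which is 0 since the weights 0 and -1
   are not opposite. *)
have a43 : a E4 E3 = 0.
  apply: bN => y; have [c0 [c1 [c2 [c3 ->]]]] := lifts4_span ev_unit y L.
  have a31 : a E3 E1 = E3 by rewrite aC a13 opprK.
  have b43 : b E4 E3 = 0.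
    by rewrite -a31 aC a13 opprK -[X in b _ X]opprK -a13 bNr -bI aC a14 oppr0 bC b0r oppr0.
  rewrite !bDr !bZr !bI a31 a11 [a E3 E2]aC [a E3 E4]aC !bNr -!bI a11 [a E4 E2]aC a24.
  by rewrite oppr0 ![b 0 _]bC !b0r b43 oppr0 !mulr0 !addr0.
have r1_4 f : r E1 (r E4 f) = r E4 (r E1 f) by rewrite rcomm a14 r0l add0r.
(* E4 commutes with E1, so it preserves the weight lines, and with E2, so it has the same eigenvalue
   on f6 and F5 = [E2, f6]. Skewness for [w] then gives 2 d w(F5, f6) = 0, and non-degeneracy makes
   the action of E4 vanish. *)
have [d46 r46] : exists c, r E4 f6 = c *: f6.
  by apply: weight_Nhalf; rewrite r1_4 r16 rNr rZr.
have r45 : r E4 F5 = d46 *: F5.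
  have := rM E4 E2 f6; rewrite aC a24 oppr0 r0l r26 r46 rZr r26 => /esym/eqP.
  by rewrite subr_eq0 => /eqP.
have d56 : d46 * w F5 f6 = 0.
  apply: (@double_eq0 A^o).
  by have := wI E4 F5 f6; rewrite r45 r46 wZl wZr => h'; rewrite {1}h' addNr.
have r45_0 : r E4 F5 = 0.
  by apply: (w_nondeg F5E); rewrite r45 wZl ?w_alt ?mulr0.
have r46_0 : r E4 f6 = 0.
  by apply: (w_nondeg F5E); rewrite r46 wZl ?w_alt ?mulr0 // wC mulrN d56 oppr0.
have r36 : r E3 f6 = 0 by apply: qJ.
(* The remaining brackets come from E2: the action of [E2, E3] on f6 gives [E3, F5], then [E2,
   [f6, f6]] gives [F5, f6], and [E2, [F5, f6]] gives [F5, F5]. *)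
have r35 : r E3 F5 = (h * s) *: f6.
  have := rM E2 E3 f6; rewrite r36 r0r sub0r r26 -/H HE4 rDl rZl r46_0 r16 add0r.
  by rewrite scalerN scalerA mulrC => /oppr_inj.
have q56 : q F5 f6 = h *: H.
  rewrite /H [a E2 E3]qM r26 [q f6 F5]qC -mulr2n -scaler_nat scalerA mulrC h2.
  by rewrite scale1r.
exists E2, E4, s; split=> //; split=> //.
- by split=> //; rewrite aC a43 oppr0.
- have := qM E2 F5 f6; rewrite r25 r26 [q 0 _]qC q0r add0r q56 aZr.
  by rewrite aC aH2 scalerN scalerA.
- by rewrite q56 HE4.
Qed.
End Weights.

(** The second parameter is [h * s] because the family has [e2, e3] = e4 + 2 s e1, while the basis
    found has E4 + s E1. *)
Lemma normal_form : exists (M : 'M[A]_4) (P : 'M[A]_2) (s h : A),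
  [/\ map_mx ev M = 1%:M, map_mx ev P = 1%:M, ev s = 0, 2 * h = 1 &
    forall x y f g, let z := family_bracket h (h * s) (x, f) (y, g) in
      a (x *m M) (y *m M) + q (f *m P) (g *m P) = z.1 *m M /\
      r (x *m M) (g *m P) - r (y *m M) (f *m P) = z.2 *m P].
Proof.
have [E1 [F5 [h [E1E F5E h2 r15 r16]]]] := odd_eigenbasis.
have [E2 [E4 [s []]]] := normal_form_brackets E1E F5E h2 r15 r16.
set E3 := q f6 f6 => L ev_s [a12 a13 a14 a23 [a24 a34]].
move=> [r25 r26 r35 r36 [r45 r46]] [q55 q56].
have q66 : q f6 f6 = E3 by []. clearbody E3.
exists (rows4 E1 E2 E3 E4), (rows2 F5 f6), s, h; split=> //.
- exact: map_rows4.
- exact: map_rows2.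
have aa x : a x x = 0.
  by apply: (@double_eq0 'rV[A]_4); rewrite [X in X + _]aC addNr.
have {}a12 : (a E1 E2 = E2) * (a E2 E1 = - E2) by rewrite [a E2 E1]aC a12.
have {}a13 : (a E1 E3 = - E3) * (a E3 E1 = E3) by rewrite [a E3 E1]aC a13 opprK.
have {}a14 : (a E1 E4 = 0) * (a E4 E1 = 0) by rewrite [a E4 E1]aC a14 oppr0.
have {}a23 : (a E2 E3 = E4 + s *: E1) * (a E3 E2 = - (E4 + s *: E1)).
  by rewrite [a E3 E2]aC a23.
have {}a24 : (a E2 E4 = 0) * (a E4 E2 = 0) by rewrite [a E4 E2]aC a24 oppr0.
have {}a34 : (a E3 E4 = 0) * (a E4 E3 = 0) by rewrite [a E4 E3]aC a34 oppr0.
have {}q56 : (q F5 f6 = h *: (E4 + s *: E1)) * (q f6 F5 = h *: (E4 + s *: E1)).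
  by rewrite [q f6 F5]qC q56.
move=> x y f g /=; rewrite !mul_rows4 !mul_rows2 !(row4E, row2E).
rewrite [2 * (h * s)]mulrA h2 !mul1r; split.
- rewrite !(aDl, aDr, aZl, aZr) !(aa, a12, a13, a14, a23, a24, a34).
  rewrite !(qDl, qDr, qZl, qZr) !(q55, q56, q66).
  by apply/rowP => j; rewrite !mxE; ring.
- rewrite !(rDl, rDr, rZl, rZr) !(r15, r16, r25, r26, r35, r36, r45, r46).
  by apply/rowP => j; rewrite !mxE; ring.
Qed.
End NormalForm.

(** * Units of the power series ring *)

Section Units.
Variable K : fieldType.

(** Geometric series: after scaling by the constant coefficient, c = 1 - x with x(0) = 0. *)
Lemma fps_unit (c : fps K) : coef_fps c 0%N != 0 -> exists c', c' * c = 1.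
Proof.
set c0 := coef_fps c 0%N => c0_neq0.
pose x : fps K := 1 - const_fps c0^-1 * c.
have x0 : coef_fps x 0%N = 0.
  by rewrite coef_fpsD coef_fpsN /= big_ord1 /= mulVf // subrr.
have xE : const_fps c0^-1 * c = 1 - x by rewrite opprB addrC subrK.
clearbody x.
have xn n k : (k < n)%N -> coef_fps (x ^+ n) k = 0.
  elim: n k => // n IH k; rewrite ltnS exprS => kn /=.
  rewrite big1 // => -[[|i] /= ik] _; first by rewrite x0 mul0r.
  rewrite IH ?mulr0 //; apply: leq_trans kn; rewrite ltnS in ik.
  by rewrite -{2}(subnK ik) addnS ltnS leq_addr.
(* The powers x^n with n > k have no coefficient of degree k, so the infinite sum may be cut at n =
   k in that degree. *)
pose S : fps K := Fps (fun k => coef_fps (\sum_(n < k.+1) x ^+ n) k).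
have SE k j : (j <= k)%N -> coef_fps S j = coef_fps (\sum_(n < k.+1) x ^+ n) j.
  move=> jk; rewrite /S /= !coef_fps_sum.
  rewrite (big_ord_widen k.+1 (fun n => coef_fps (x ^+ n) j)) ?ltnS //.
  rewrite [RHS](bigID (fun n : 'I_k.+1 => (n < j.+1)%N)) /=.
  by rewrite [X in _ = _ + X]big1 ?addr0 // => n; rewrite -leqNgt; apply: xn.
exists (S * const_fps c0^-1); rewrite -mulrA xE.
apply: fpsP => k; transitivity (coef_fps ((\sum_(n < k.+1) x ^+ n) * (1 - x)) k).
  by apply: eq_bigr => j _; rewrite (SE k) // -ltnS.
by rewrite mulrC -opprB mulNr -subrX1 opprB coef_fpsD coef_fpsN xn // subr0.
Qed.
End Units.

(** * The tables of structure constants in coordinates *)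

Section Tables.
Variable K : numFieldType.

Definition svec_coord m n (z : svec K m.+1 n.+1) (k : nat) : K :=
  if (k < m.+1)%N then z.1`_{k} else z.2`_{k - m.+1}.

Lemma row_mx_coord m n (z : svec K m.+1 n.+1) (i : 'I_(m.+1 + n.+1)) :
  row_mx z.1 z.2 0 i = svec_coord z i.
Proof.
rewrite /svec_coord mxE; case: splitP => j ij; rewrite ij.
  by rewrite inord_val.
by rewrite addKn inord_val.
Qed.

(** Ranges of natural numbers compute, so for concrete dimensions the double sum unfolds into
    explicit terms by [unlock]. *)
Lemma table_bracketE m n c (x y : svec K m.+1 n.+1) : table_bracket c x y =
  \sum_(0 <= i < m.+1 + n.+1) \sum_(0 <= j < m.+1 + n.+1)
    (svec_coord x i * svec_coord y j) *:
    (if (i <= j)%N then c i.+1 j.+1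
     else - ((-1) ^+ ((m < i)%N && (m < j)%N) *: c j.+1 i.+1)).
Proof.
rewrite big_mkord; apply: eq_bigr => i _; rewrite big_mkord; apply: eq_bigr => j _.
by rewrite !row_mx_coord.
Qed.

Lemma sbasis42E k : sbasis K 4 2 k =
  (row4 (1 == k)%:R (2 == k)%:R (3 == k)%:R (4 == k)%:R,
   row2 (5 == k)%:R (6 == k)%:R).
Proof.
by apply: injective_projections; [apply: row4P; split | apply: row2P; split];
   rewrite ?(row4E, row2E) mxE inordK.
Qed.

Lemma sbasis32E k : sbasis K 3 2 k =
  (row3 (1 == k)%:R (2 == k)%:R (3 == k)%:R, row2 (4 == k)%:R (5 == k)%:R).
Proof.
by apply: injective_projections; [apply: row3P; split | apply: row2P; split];
   rewrite ?(row3E, row2E) mxE inordK.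
Qed.

Lemma g4232_family : @g4232 K = family_bracket 2^-1 0.
Proof.
apply: funext => x; apply: funext => y.
rewrite /g4232 table_bracketE unlock /= /svec_coord /=.
rewrite !(scaler0, oppr0, addr0, add0r) expr0 expr1 !scale1r !scaleN1r.
rewrite !subSS !subn0 /family_bracket (_ : 2 * 2^-1 = 1); last first.
  by rewrite mulfV // pnatr_eq0.
rewrite !sbasis42E.
by apply: injective_projections => /=; [apply: row4P; split | apply: row2P; split];
   rewrite ?(row4E, row2E, mxE) /= ?(row4E, row2E, mxE); ring.
Qed.

Lemma osp12E (x y : svec K 3 2) : osp12 x y =
  let a := x.1 in let b := y.1 in let f := x.2 in let g := y.2 in
  (row3
    (- 2 * (a`_{0} * b`_{2} - a`_{2} * b`_{0}) + 2^-1 * (f`_{0} * g`_{0}))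
    (2 * (a`_{1} * b`_{2} - a`_{2} * b`_{1}) - 2^-1 * (f`_{1} * g`_{1}))
    (a`_{0} * b`_{1} - a`_{1} * b`_{0}
      + 4^-1 * (f`_{0} * g`_{1} + f`_{1} * g`_{0})),
   row2
    (a`_{2} * g`_{0} - b`_{2} * f`_{0} - (a`_{0} * g`_{1} - b`_{0} * f`_{1}))
    (- (a`_{2} * g`_{1} - b`_{2} * f`_{1}) - (a`_{1} * g`_{0} - b`_{1} * f`_{0}))).
Proof.
rewrite /osp12 table_bracketE unlock /= /svec_coord /=.
rewrite !(scaler0, oppr0, addr0, add0r) expr0 expr1 !scale1r !scaleN1r.
rewrite !subSS !subn0 !sbasis32E.
by apply: injective_projections => /=; [apply: row3P; split | apply: row2P; split];
   rewrite ?(row3E, row2E, mxE) /= ?(row3E, row2E, mxE); ring.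
Qed.
End Tables.

(** * Components of the bracket and of the form by parity *)

Section Splitting.
Variables (A : comNzRingType) (br : svec A 4 2 -> svec A 4 2 -> svec A 4 2).
Hypothesis br_lie : lie_superalgebra br.
Let a x y := (br (x, 0) (y, 0)).1.
Let r x f := (br (x, 0) (0, f)).2.
Let q f g := (br (0, f) (0, g)).1.

Let even_hom x : homogeneous false ((x, 0) : svec A 4 2). Proof. by []. Qed.
Let odd_hom f : homogeneous true ((0, f) : svec A 4 2). Proof. by []. Qed.
#[local] Hint Resolve even_hom odd_hom : core.

Lemma br_even x y : br (x, 0) (y, 0) = (a x y, 0).
Proof.
have [[_ _ hom _] _] := br_lie.
by rewrite [LHS]surjective_pairing (hom false false (x, 0) (y, 0)).
Qed.

Lemma br_even_odd x f : br (x, 0) (0, f) = (0, r x f).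
Proof.
have [[_ _ hom _] _] := br_lie.
by rewrite [LHS]surjective_pairing (hom false true (x, 0) (0, f)).
Qed.

Lemma br_odd_even x f : br (0, f) (x, 0) = (0, - r x f).
Proof.
have [[_ _ _ sk] _] := br_lie.
rewrite (sk false true (x, 0) (0, f)) // scale1r br_even_odd.
by apply: injective_projections; rewrite /= ?oppr0.
Qed.

Lemma br_odd f g : br (0, f) (0, g) = (q f g, 0).
Proof.
have [[_ _ hom _] _] := br_lie.
by rewrite [LHS]surjective_pairing (hom true true (0, f) (0, g)).
Qed.

Lemma br_addr x y z : br x (y + z) = br x y + br x z.
Proof. by have [[l _ _ _] _] := br_lie; have := l x 1 y z; rewrite !scale1r. Qed.
Lemma br_addl x y z : br (x + y) z = br x z + br y z.
Proof. by have [[_ l _ _] _] := br_lie; have := l z 1 x y; rewrite !scale1r. Qed.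

Lemma svec_split (x : svec A 4 2) : x = (x.1, 0) + (0, x.2).
Proof. by apply: injective_projections; rewrite /= ?addr0 ?add0r. Qed.

Lemma br_split x y f g : br (x, f) (y, g) = (a x y + q f g, r x g - r y f).
Proof.
rewrite (svec_split (x, f)) (svec_split (y, g)) !br_addl !br_addr.
rewrite br_even br_even_odd br_odd_even br_odd.
apply: injective_projections => /=; first by rewrite add0r addr0.
by rewrite add0r addr0.
Qed.

Lemma even_part_linear x : linear (a x).
Proof.
move=> c y z; have [[l _ _ _] _] := br_lie; have := l (x, 0) c (y, 0) (z, 0).
by rewrite -(_ : (c *: y + z, 0) = c *: (y, 0) + (z, 0)) ?br_even => [[]|];
   last by apply: injective_projections; rewrite /= ?scaler0 ?addr0.
Qed.

Lemma even_part_skew x y : a y x = - a x y.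
Proof.
have [[_ _ _ sk] _] := br_lie; have := sk false false (x, 0) (y, 0).
by rewrite scale1r !br_even => /(_ erefl erefl) [].
Qed.

Let signs : ((-1 : A) ^+ (true && true) = -1) * ((-1 : A) ^+ (false && true) = 1)
  * ((-1 : A) ^+ (true && false) = 1) * ((-1 : A) ^+ (false && false) = 1).
Proof. by []. Qed.

Let pair_fst x f y g : (x, f) = (y, g) :> svec A 4 2 -> x = y. Proof. by case. Qed.
Let pair_snd x f y g : (x, f) = (y, g) :> svec A 4 2 -> f = g. Proof. by case. Qed.

Let even_comb c x y : c *: (x, 0) + (y, 0) = (c *: x + y, 0) :> svec A 4 2.
Proof. by apply: injective_projections; rewrite /= ?scaler0 ?addr0. Qed.
Let odd_comb c f g : c *: (0, f) + (0, g) = (0, c *: f + g) :> svec A 4 2.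
Proof. by apply: injective_projections; rewrite /= ?scaler0 ?addr0. Qed.
Let even_add x y : (x, 0) + (y, 0) = (x + y, 0) :> svec A 4 2.
Proof. by apply: injective_projections; rewrite /= ?addr0. Qed.
Let odd_add f g : (0, f) + (0, g) = (0, f + g) :> svec A 4 2.
Proof. by apply: injective_projections; rewrite /= ?addr0. Qed.

Variables (K : numFieldType) (ev : {rmorphism A -> K}).
Hypothesis ev_unit : forall c, ev c != 0 -> exists c', c' * c = 1.
Variable B : svec A 4 2 -> svec A 4 2 -> A.
Hypothesis B_metric : metric_form br B.
Let mapV (x : svec A 4 2) : svec K 4 2 := (map_mx ev x.1, map_mx ev x.2).
Hypothesis br_red : forall x y, mapV (br x y) = family_bracket 2^-1 0 (mapV x) (mapV y).

(** Both [x] and 0 represent the zero functional, and the representative is unique. *)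
Lemma metric_form_inj x : (forall y, B x y = 0) -> x = 0.
Proof.
have [l1 l2 _ _ _ dual] := B_metric => Bx0.
have [z [_ zE]] := dual \0.
rewrite -(zE x) //; apply: zE => y /=.
by have := l2 y (-1) 0 0; rewrite scaler0 addr0 => ->; rewrite scaleN1r addNr.
Qed.

Lemma metric_normal_form : exists (M : 'M[A]_4) (P : 'M[A]_2) (s h : A),
  [/\ map_mx ev M = 1%:M, map_mx ev P = 1%:M, ev s = 0, 2 * h = 1 &
    forall x y, br (x.1 *m M, x.2 *m P) (y.1 *m M, y.2 *m P) =
      let z := family_bracket h (h * s) x y in (z.1 *m M, z.2 *m P)].
Proof.
have [[l1 l2 hom sk] jac] := br_lie.
have [B1 B2 B0 Bsk Binv _] := B_metric.
have u3 : exists c' : A, c' * 3 = 1.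
  by apply: ev_unit; rewrite rmorph_nat pnatr_eq0.
have B0' x f : B (x, 0) (0, f) = 0 by apply: (B0 false).
have B0'' x f : B (0, f) (x, 0) = 0 by apply: (B0 true).
have BDr x y z : B x (y + z) = B x y + B x z.
  by have := B1 x 1 y z; rewrite !scale1r.
have BDl x y z : B (x + y) z = B x z + B y z.
  by have := B2 z 1 x y; rewrite !scale1r.
have [] := @normal_form A K ev ev_unit a r q _ _ _ _ _ _ _ _ _ _
   (fun x y => B (x, 0) (y, 0)) (fun f g => B (0, f) (0, g)).
- exact: even_part_linear.
- exact: even_part_skew.
- move=> x y z; have := jac false false (x, 0) (y, 0) (z, 0) erefl erefl.
  by rewrite signs scale1r !br_even even_add => /pair_fst.
- move=> f c x y; have := l2 (0, f) c (x, 0) (y, 0).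
  by rewrite even_comb !br_even_odd odd_comb => /pair_snd.
- move=> x c f g; have := l1 (x, 0) c (0, f) (0, g).
  by rewrite odd_comb !br_even_odd odd_comb => /pair_snd.
- move=> x y f; have := jac false false (x, 0) (y, 0) (0, f) erefl erefl.
  rewrite signs scale1r br_even !br_even_odd odd_add => /pair_snd ->.
  by rewrite addrK.
- move=> f c g k; have := l1 (0, f) c (0, g) (0, k).
  by rewrite odd_comb !br_odd even_comb => /pair_fst.
- move=> f g; have := sk true true (0, f) (0, g) erefl erefl.
  by rewrite signs scaleN1r opprK !br_odd => /pair_fst.
- move=> x f g; have := jac false true (x, 0) (0, f) (0, g) erefl erefl.
  by rewrite signs scale1r !br_even_odd !br_odd br_even even_add => /pair_fst.
(* On one odd vector three times the Jacobi identity only says 3 [[f, f], f] = 0, hence the inverse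
   of 3. *)
- move=> f; have := jac true true (0, f) (0, f) (0, f) erefl erefl.
  rewrite signs scaleN1r br_odd br_odd_even br_even_odd.
  move/pair_snd => /= eq3; have {eq3} : 3 *: r (q f f) f = 0.
    have <- : - (- r (q f f) f - (r (q f f) f - - r (q f f) f)) = 3 *: r (q f f) f.
      by apply/rowP => j; rewrite !mxE; ring.
    by rewrite {1}eq3 subrr oppr0.
  move: (r _ _) => t t3; have [c c3] := u3.
  by rewrite -[t]scale1r -c3 -scalerA t3 scaler0.
- by move=> x c y z; have := B1 (x, 0) c (y, 0) (z, 0); rewrite even_comb.
- by move=> x y; rewrite (Bsk false false) // mul1r.
- by move=> x y z; have := Binv (x, 0) (y, 0) (z, 0); rewrite !br_even.
- move=> x xB; have : ((x, 0) : svec A 4 2) = 0.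
    by apply: metric_form_inj => y; rewrite (svec_split y) BDr xB B0' addr0.
  by case.
- by move=> f c g k; have := B1 (0, f) c (0, g) (0, k); rewrite odd_comb.
- by move=> f g; rewrite (Bsk true true) // mulN1r.
- move=> x f g; have := Binv (0, f) (x, 0) (0, g).
  rewrite br_odd_even br_even_odd => <-.
  apply/eqP; rewrite -addr_eq0 -BDl odd_add subrr; apply/eqP.
  by have := B2 (0, g) (-1) 0 0; rewrite scaler0 addr0 scaleN1r addNr.
- move=> f fB; have : ((0, f) : svec A 4 2) = 0.
    by apply: metric_form_inj => y; rewrite (svec_split y) BDr fB B0'' addr0.
  by case.
- move=> x y; have := br_red (x, 0) (y, 0); rewrite /mapV /= !map_mx0.
  by rewrite [LHS]surjective_pairing => /(congr1 fst) /= ->.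
- move=> x f; have := br_red (x, 0) (0, f); rewrite /mapV /= !map_mx0.
  by move=> /(congr1 snd) /= ->.
- move=> f g; have := br_red (0, f) (0, g); rewrite /mapV /= !map_mx0.
  by move=> /(congr1 fst) /= ->.
move=> M [P [s [h [M1 P1 s0 h2 brE]]]]; exists M, P, s, h; split=> //.
by move=> [x f] [y g]; rewrite br_split /=; have /= [-> ->] := brE x y f g.
Qed.
End Splitting.

(** * Metric deformations are equivalent to members of the family *)

Section FormalDeformations.
Variable K : numFieldType.

(** The factor 1/2 at i = 1 cancels the 2 in front of s, so that this is the deformation [e2, e3] =
    e4 + t e1. *)
Definition jump_family (i : nat) : svec K 4 2 -> svec K 4 2 -> svec K 4 2 :=
  family_bracket (if i == 0%N then 2^-1 else 0) (if i == 1%N then 2^-1 else 0).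

Lemma coef_fps_half (h : fps K) : 2 * h = 1 ->
  forall i, coef_fps h i = if i == 0%N then 2^-1 else 0.
Proof.
move=> h2 i; have two_neq0 : 2 != 0 :> K by rewrite pnatr_eq0.
apply: (mulfI two_neq0).
have := congr1 (fun c => coef_fps c i) h2; rewrite mulr_natl coef_fpsMn coef_fps1.
by rewrite mulr_natl => ->; case: eqP => _; rewrite ?mulfV ?mulr0.
Qed.

Lemma coef_fps_halfM (h s : fps K) : 2 * h = 1 ->
  forall i, coef_fps (h * s) i = 2^-1 * coef_fps s i.
Proof.
move=> h2 i; have two_neq0 : 2 != 0 :> K by rewrite pnatr_eq0.
apply: (mulfI two_neq0); rewrite mulrA mulfV // mul1r mulr_natl -coef_fpsMn.
by rewrite -mulr_natl mulrA h2 mul1r.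
Qed.

Lemma family_bracketZ (A : comNzRingType) c o s (x y : svec A 4 2) :
  c *: family_bracket o s x y = family_bracket (c * o) (c * s) x y.
Proof. by coords; ring. Qed.

Lemma family_bracketD (A : comNzRingType) o s o' s' (x y : svec A 4 2) :
  family_bracket o s x y + family_bracket o' s' x y =
  family_bracket (o + o') (s + s') x y.
Proof. by coords; ring. Qed.

Lemma family_bracket0 (A : comNzRingType) (x y : svec A 4 2) :
  family_bracket 0 0 x y = 0.
Proof. by coords; ring. Qed.

Lemma family_bracket_sum (A : comNzRingType) n (o s : nat -> A) (x y : svec A 4 2) :
  \sum_(i < n) family_bracket (o i) (s i) x y =
  family_bracket (\sum_(i < n) o i) (\sum_(i < n) s i) x y.
Proof.
elim: n => [|n IH]; first by rewrite !big_ord0 family_bracket0.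
by rewrite !big_ord_recr /= IH family_bracketD.
Qed.

(** The deformation stops after the first order in t, so only the powers s^0 and s^1 enter the
    substitution. *)
Lemma reparametrize_jump_family (h s : fps K) : 2 * h = 1 -> coef_fps s 0%N = 0 ->
  reparametrize s jump_family =
  fun i => family_bracket (coef_fps h i) (coef_fps (h * s) i).
Proof.
move=> h2 s0; apply: funext => k; apply: funext => x; apply: funext => y.
rewrite /reparametrize /jump_family.
under eq_bigr => i _ do rewrite family_bracketZ.
rewrite (family_bracket_sum _ (fun i => coef_fps (s ^+ i) k * (if i == 0%N then 2^-1 else 0))
  (fun i => coef_fps (s ^+ i) k * (if i == 1%N then 2^-1 else 0))).
congr (family_bracket _ _ _ _).
  rewrite (coef_fps_half h2) big_ord_recl expr0 coef_fps1 big1 ?addr0 /=.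
    by case: (k == 0%N); rewrite ?mul1r ?mul0r.
  by move=> i _; rewrite mulr0.
(* For k = 0 the sum does not reach i = 1, and the term s^1 missing there is covered by s(0) = 0. *)
rewrite (coef_fps_halfM _ h2) big_ord_recl mulr0 add0r; case: k => [|k].
  by rewrite big_ord0 s0 mulr0.
rewrite big_ord_recl expr1 big1 ?addr0 /=; first by rewrite mulrC.
by move=> i _; rewrite mulr0.
Qed.

Lemma constant_deformation_g4232 (h s : fps K) : 2 * h = 1 -> s = 0 ->
  constant_deformation (@g4232 K) =
  fun i => family_bracket (coef_fps h i) (coef_fps (h * s) i).
Proof.
move=> h2 ->; apply: funext => k; apply: funext => x; apply: funext => y.
rewrite /constant_deformation g4232_family (coef_fps_half h2) mulr0 coef_fps0.
by case: eqP => // _; rewrite family_bracket0.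
Qed.

Lemma constant_coef_series_bracket (m n : nat)
    (phi : nat -> svec K m n -> svec K m n -> svec K m n) x y :
  svec_coef 0 (series_bracket phi x y) =
  phi 0%N (svec_coef 0 x) (svec_coef 0 y).
Proof.
by apply: injective_projections; apply/rowP => j;
  rewrite mxE (series_bracket_fst, series_bracket_snd) /= !big_ord1 /=
          big_mkcond big_ord1.
Qed.

Lemma deformation_normal_form phi : metric_deformation (@g4232 K) phi ->
  exists s h : fps K, [/\ coef_fps s 0%N = 0, 2 * h = 1 &
    equivalent_deformations phi
      (fun i => family_bracket (coef_fps h i) (coef_fps (h * s) i))].
Proof.
move=> [[phi0 _ _] [br_lie [B B_metric]]].
have red x y : (map_mx (@constant_coef K) (series_bracket phi x y).1,
                map_mx (@constant_coef K) (series_bracket phi x y).2) =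
    family_bracket 2^-1 0 (map_mx (@constant_coef K) x.1, map_mx (@constant_coef K) x.2)
       (map_mx (@constant_coef K) y.1, map_mx (@constant_coef K) y.2).
  have E z : (map_mx (@constant_coef K) z.1, map_mx (@constant_coef K) z.2) = svec_coef 0 z.
    by apply: injective_projections; apply/rowP => j; rewrite !mxE.
  by rewrite !E constant_coef_series_bracket phi0 g4232_family.
pose ev : {rmorphism fps K -> K} := @constant_coef K.
have ev_unit c : ev c != 0 -> exists c', c' * c = 1 by apply: fps_unit.
have [M [P [s [h [M1 P1 s0 h2 brE]]]]] :=
  @metric_normal_form _ _ br_lie _ ev ev_unit _ B_metric red.
have [M' M'M MM'] := local_mx_inverse ev_unit M1.
have [P' P'P PP'] := local_mx_inverse ev_unit P1.
exists s, h; split=> //.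
(* The rows of [M] and [P] are the new basis, so passing to new coordinates is multiplication by the
   inverse matrices. *)
exists (fun i (x : svec K 4 2) => (x.1 *m map_mx (fun c => coef_fps c i) M',
   x.2 *m map_mx (fun c => coef_fps c i) P')); split.
- move=> x; have -> : map_mx (fun c => coef_fps c 0%N) M' = 1%:M.
    by have := congr1 (map_mx ev) M'M; rewrite map_mxM M1 mulmx1 map_mx1.
  have -> : map_mx (fun c => coef_fps c 0%N) P' = 1%:M.
    by have := congr1 (map_mx ev) P'P; rewrite map_mxM P1 mulmx1 map_mx1.
  by rewrite !mulmx1 -surjective_pairing.
- move=> i c x y; apply: injective_projections => /=;
  by rewrite mulmxDl -scalemxAl.
- by move=> i [] x; rewrite /homogeneous /= => ->; rewrite mul0mx.
move=> x y; rewrite !series_map_mulmx series_bracket_family.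
set X := svec_const x; set Y := svec_const y.
have inv (Z : svec (fps K) 4 2) : Z = (Z.1 *m M' *m M, Z.2 *m P' *m P).
  by rewrite -!mulmxA M'M P'P !mulmx1 -surjective_pairing.
have etaE (c : fps K) : Fps (coef_fps c) = c by case: c.
have -> : series_bracket phi X Y =
    let z := family_bracket h (h * s) (X.1 *m M', X.2 *m P') (Y.1 *m M', Y.2 *m P') in
    (z.1 *m M, z.2 *m P).
  by rewrite {1}(inv X) {1}(inv Y); apply: (brE (_, _) (_, _)).
rewrite !etaE; move: (family_bracket _ _ _ _) => z; cbn [fst snd].
rewrite -[_ *m M *m M']mulmxA -[_ *m P *m P']mulmxA MM' PP' !mulmx1.
by rewrite -surjective_pairing.
Qed.
End FormalDeformations.

(** * The standard deformation: non-triviality and generic fibre *)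

Section JumpFamily.
Variable K : numFieldType.
Let phi := @jump_family K.

Let half2 : 2 * 2^-1 = 1 :> K.
Proof. by rewrite mulfV // pnatr_eq0. Qed.

Let half_fps : 2 * (Fps (fun i => if i == 0%N then 2^-1 else 0) : fps K) = 1.
Proof.
apply: fpsP => i; rewrite mulr_natl coef_fpsMn coef_fps1 /=.
by case: i => [|i] /=; rewrite ?mul0rn // -[2^-1 *+ 2]mulr_natl half2.
Qed.

Lemma jump_family_metric_deformation : metric_deformation (@g4232 K) phi.
Proof.
have E : series_bracket phi = family_bracket
    (Fps (fun i => if i == 0%N then 2^-1 else 0))
    (Fps (fun i => if i == 1%N then 2^-1 else 0)).
  by apply: funext => x; apply: funext => y; rewrite /phi /jump_family series_bracket_family.
split.
  split; first by move=> x y; rewrite g4232_family.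
    by move=> i; apply: family_bracket_skew.
  by rewrite E; apply: family_bracket_lie.
rewrite E; split; first exact: family_bracket_lie.
eexists; apply: family_metric_form; exact: half_fps.
Qed.

Lemma svec_coef_series m n (u : nat -> svec K m n) k : svec_coef k (svec_series u) = u k.
Proof. by apply: injective_projections; apply/rowP => j; rewrite !mxE. Qed.

Lemma svec_coef_const m n (x : svec K m n) k :
  svec_coef k (svec_const x) = if k == 0%N then x else 0.
Proof. exact: svec_coef_series. Qed.

(** Comparing coefficients of t, with D = psi_1: the infinitesimal parts of equivalent deformations
    with a common constant term differ by a coboundary. *)
Lemma equivalent_deformations_order1 m n
    (br1 br2 : nat -> svec K m n -> svec K m n -> svec K m n) :
  (forall i, even_super_skew (br1 i)) -> (forall i, even_super_skew (br2 i)) ->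
  equivalent_deformations br1 br2 ->
  exists D : svec K m n -> svec K m n, D 0 = 0 /\ forall x y,
    D (br1 0%N x y) + br1 1%N x y =
    br2 0%N (D x) y + br2 0%N x (D y) + br2 1%N x y.
Proof.
move=> sk1 sk2 [psi [psi0 psi_lin _ psiE]]; exists (psi 1%N).
split; first by have := psi_lin 1%N (-1) 0 0; rewrite scaleN1r addNr scaleN1r addNr.
move=> x y.
have br0r br i z : (forall i, even_super_skew (br i)) -> br i z 0 = 0 :> svec K m n.
  move=> sk; have [l _ _ _] := sk i.
  by have := l z (-1) 0 0; rewrite scaleN1r addNr scaleN1r addNr.
have br0l br i z : (forall i, even_super_skew (br i)) -> br i 0 z = 0 :> svec K m n.
  move=> sk; have [_ l _ _] := sk i.
  by have := l z (-1) 0 0; rewrite scaleN1r addNr scaleN1r addNr.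
have sum_ord2 (P : pred nat) (F : nat -> svec K m n) :
    \sum_(i < 2 | P i) F i = (if P 0%N then F 0%N else 0) + (if P 1%N then F 1%N else 0).
  by rewrite big_mkcond !big_ord_recl big_ord0 /= addr0.
have map1 U : svec_coef 1 (series_map psi U) =
    psi 0%N (svec_coef 1 U) + psi 1%N (svec_coef 0 U).
  rewrite svec_coef_series.
  rewrite (sum_ord2 predT (fun i => \sum_(j < 2 | (i + j == 1)%N) psi i (svec_coef j U))).
  rewrite (sum_ord2 (fun j => 0 + j == 1)%N (fun j => psi 0%N (svec_coef j U))).
  rewrite (sum_ord2 (fun j => 1 + j == 1)%N (fun j => psi 1%N (svec_coef j U))).
  by rewrite /= add0r addr0.
have map0 U : svec_coef 0 (series_map psi U) = psi 0%N (svec_coef 0 U).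
  by rewrite svec_coef_series big_ord1 /= big_mkcond big_ord1.
have bracket1 (br : nat -> svec K m n -> svec K m n -> svec K m n) U V :
    svec_coef 1 (series_bracket br U V) =
    br 0%N (svec_coef 0 U) (svec_coef 1 V) + br 0%N (svec_coef 1 U) (svec_coef 0 V)
    + br 1%N (svec_coef 0 U) (svec_coef 0 V).
  pose F i j l := br i (svec_coef j U) (svec_coef l V).
  rewrite svec_coef_series.
  rewrite (sum_ord2 predT (fun i => \sum_(j < 2) \sum_(l < 2 | (i + j + l == 1)%N) F i j l)).
  rewrite (sum_ord2 predT (fun j => \sum_(l < 2 | (0 + j + l == 1)%N) F 0%N j l)).
  rewrite (sum_ord2 predT (fun j => \sum_(l < 2 | (1 + j + l == 1)%N) F 1%N j l)).
  rewrite (sum_ord2 (fun l => 0 + 0 + l == 1)%N (F 0%N 0%N)).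
  rewrite (sum_ord2 (fun l => 0 + 1 + l == 1)%N (F 0%N 1%N)).
  rewrite (sum_ord2 (fun l => 1 + 0 + l == 1)%N (F 1%N 0%N)).
  rewrite (sum_ord2 (fun l => 1 + 1 + l == 1)%N (F 1%N 1%N)).
  by rewrite /= !(add0r, addr0).
have := congr1 (svec_coef 1) (psiE x y).
rewrite map1 !bracket1 constant_coef_series_bracket !map1 !map0 !svec_coef_const /=.
by rewrite !psi0 !br0r // !br0l // !(add0r, addr0) addrC [X in _ = X + _]addrC.
Qed.

(** A coboundary D is contradictory on e4. The pair (e2, e3) forces the e1 coordinate of D(e4) to be
    -1, since no undeformed bracket has an e1 component. The pair (e4, e2) forces it to be 0, since
    e4 is central and [e1, e2] = e2. *)
Lemma jump_family_nontrivial : ~ trivial_deformation (@g4232 K) phi.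
Proof.
have sk o s := @family_bracket_skew K o s.
rewrite /trivial_deformation (constant_deformation_g4232 half_fps erefl).
move=> /equivalent_deformations_order1[||D [D0 DE]] //; do ?by move=> i; apply: sk.
pose e2 : svec K 4 2 := (row4 0 1 0 0, 0).
pose e3 : svec K 4 2 := (row4 0 0 1 0, 0).
pose e4 : svec K 4 2 := (row4 0 0 0 1, 0).
move: DE; rewrite mulr0 /= /phi /jump_family /= => DE.
have := DE e2 e3; have := DE e4 e2.
have -> : family_bracket 2^-1 0 e2 e3 = e4.
  by coords; rewrite ?half2; ring.
have -> : family_bracket 2^-1 0 e4 e2 = 0.
  by coords; ring.
rewrite D0 => /(congr1 (fun x : svec K 4 2 => x.1`_{1})) E42
  /(congr1 (fun x : svec K 4 2 => x.1`_{0})) E23.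
move: E42 E23; rewrite /family_bracket /= !mxE !inordK //= half2.
rewrite !(mul0r, mulr0, mulr1, mul1r, oppr0, add0r, addr0, subr0) => <- /eqP.
by rewrite add0r oner_eq0.
Qed.

Lemma jump_family_bracket_at t : bracket_at phi t (family_bracket 2^-1 (t / 2)).
Proof.
(* The partial sums are constant from N = 2 on. *)
move=> x y; apply: cvg_near_cst; exists 2%N => // -[|[|N]] //= _.
rewrite /phi /jump_family.
under eq_bigr => i _ do rewrite family_bracketZ.
rewrite (family_bracket_sum _ (fun i => t ^+ i * (if i == 0%N then 2^-1 else 0))
  (fun i => t ^+ i * (if i == 1%N then 2^-1 else 0))).
congr (family_bracket _ _ _ _).
  rewrite big_ord_recl expr0 mul1r big1 ?addr0 // => i _.
  by rewrite mulr0.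
rewrite !big_ord_recl expr1 mulr0 add0r big1 ?addr0 // => i _.
by rewrite mulr0.
Qed.

Let target := lie_dsum (@osp12 K) (@lie_abelian K 1 0).

(** The central e4 goes to the generator of the abelian summand. The correction by [t^-1] sends e4 +
    t e1 = [e2, e3] into osp(1,2), to t/2 times its e3. *)
Definition jump_iso (t : K) (x : svec K 4 2) :
    ('rV[K]_3 * 'rV[K]_1) * ('rV[K]_2 * 'rV[K]_0) :=
  ((row3 (- t * x.1`_{1}) (- (2^-1 * x.1`_{2})) (2^-1 * x.1`_{0}),
    \row_(i < 1) (x.1`_{3} - t^-1 * x.1`_{0})),
   (row2 (t * x.2`_{0}) x.2`_{1}, 0)).

Let dsumP (x y : ('rV[K]_3 * 'rV[K]_1) * ('rV[K]_2 * 'rV[K]_0)) :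
  x.1.1 = y.1.1 -> x.1.2`_{0} = y.1.2`_{0} -> x.2.1 = y.2.1 -> x = y.
Proof.
case: x y => [[x1 x2] [x3 x4]] [[y1 y2] [y3 y4]] /= -> xy ->.
congr (_, _, (_, _)); apply/rowP; last by case.
by move=> i; rewrite -(inord_val i); case: i => [[|//] /= _].
Qed.

Lemma jump_iso_linear t : linear (jump_iso t).
Proof.
move=> c x y; apply: dsumP; rewrite /jump_iso /=.
- by apply: row3P; rewrite ?(row3E, mxE) /= ?(row3E, mxE) ?inordK //=; split; ring.
- by rewrite !mxE; ring.
- by apply: row2P; rewrite ?(row2E, mxE) /= ?(row2E, mxE) ?inordK //=; split; ring.
Qed.

HB.instance Definition _ t :=
  GRing.isLinear.Build K _ _ _ (jump_iso t) (jump_iso_linear t).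

Lemma jump_family_iso (t : K) : t != 0 ->
  lie_isomorphic (family_bracket 2^-1 (t / 2)) target.
Proof.
move=> t0; have two0 : 2 != 0 :> K by rewrite pnatr_eq0.
exists (jump_iso t); split.
- move=> p x; rewrite /homogeneous; case: p => /= ->; rewrite /jump_iso /=;
    congr (_, _); try (by apply: row3P; rewrite !(row3E, mxE); split; ring).
  + by apply/rowP => i; rewrite !mxE; ring.
  + by apply: row2P; rewrite !(row2E, mxE); split; ring.
- exists (fun z : ('rV[K]_3 * 'rV[K]_1) * ('rV[K]_2 * 'rV[K]_0) =>
    (row4 (2 * z.1.1`_{2}) (- (t^-1 * z.1.1`_{0})) (- (2 * z.1.1`_{1}))
     (z.1.2`_{0} + 2 * t^-1 * z.1.1`_{2}), row2 (t^-1 * z.2.1`_{0}) z.2.1`_{1})) => z.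
    apply: injective_projections; [apply: row4P; split | apply: row2P; split];
    by rewrite ?(row4E, row2E) /jump_iso /= ?(row3E, row2E, mxE) /=; field.
  apply: dsumP; rewrite /jump_iso /=.
  + by apply: row3P; rewrite !row3E !row4E; split; field.
  + by rewrite mxE !row4E; field.
  + by apply: row2P; rewrite !row2E; split; field.
- move=> x y; apply: dsumP; rewrite /target /lie_dsum /jump_iso osp12E /=.
  + by apply: row3P; rewrite !row3E !row4E !row2E; split; field.
  + by rewrite mxE [RHS]mxE !row4E; field.
  + by apply: row2P; rewrite !row2E !row3E; split; field.
Qed.

(** In the original algebra e4 = [e2, e3] is central. In the other one a bracket has no abelian
    component, and osp(1,2) has trivial centre. *)
Lemma target_not_g4232 : ~ lie_isomorphic target (@g4232 K).
Proof.
rewrite g4232_family => -[f [_ [g fg gf] fM]].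
pose e2 : svec K 4 2 := (row4 0 1 0 0, 0).
pose e3 : svec K 4 2 := (row4 0 0 1 0, 0).
pose e4 : svec K 4 2 := (row4 0 0 0 1, 0).
pose z := target (g e2) (g e3).
have fz : f z = e4.
  by rewrite fM !gf; coords; rewrite ?half2; ring.
have zC y : target z y = 0.
  apply: (can_inj fg); rewrite fM fz linear0.
  by coords; ring.
have z12 : z.1.2 = 0 by [].
clearbody z.
have two0 : 2 != 0 :> K by rewrite pnatr_eq0.
have [H1 H2 H3] : [/\ z.1.1`_{0} = 0, z.1.1`_{1} = 0 & z.2.1 = 0].
  (* ad e3 has non-zero weights on e1, e2, e4, e5 of osp(1,2), which leaves only a multiple of e3;
     bracketing with e1 removes it. *)
  have := zC ((row3 0 0 1, 0), (0, 0)); rewrite /target /lie_dsum osp12E /=.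
  move=> /(congr1 (fun x : ('rV[K]_3 * 'rV[K]_1) * ('rV[K]_2 * 'rV[K]_0) =>
     (x.1.1, x.2.1))) /= [].
  move=> /rowP h /rowP k.
  move: (h (inord 0)) (h (inord 1)) (k (inord 0)) (k (inord 1)).
  rewrite !(row3E, row2E) ![(0 : matrix _ _ _) _ _]mxE.
  rewrite !(mulr0, mulr1, mul0r, mul1r, oppr0, add0r, addr0, subr0, opprK).
  rewrite mulNr => /eqP + /eqP + /eqP +; rewrite !oppr_eq0 !mulf_eq0 (negbTE two0) /=.
  by move=> /eqP -> /eqP -> /eqP k0 k1; split=> //; apply: row2P; rewrite !mxE.
have H4 : z.1.1`_{2} = 0.
  have := zC ((row3 1 0 0, 0), (0, 0)); rewrite /target /lie_dsum osp12E /=.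
  move=> /(congr1 (fun x : ('rV[K]_3 * 'rV[K]_1) * ('rV[K]_2 * 'rV[K]_0) =>
     x.1.1`_{0})) /=.
  rewrite !(row3E, row2E) ![(0 : matrix _ _ _) _ _]mxE.
  rewrite !(mulr0, mulr1, mul0r, mul1r, oppr0, add0r, addr0, subr0, opprK, mulNr, mulrN).
  by move/eqP; rewrite mulf_eq0 (negbTE two0) => /eqP.
have z0 : z = 0.
  apply: dsumP => //=; last by rewrite z12.
  by apply: row3P; rewrite !mxE.
move: fz; rewrite z0 linear0 => /(congr1 (fun x : svec K 4 2 => x.1`_{3}))/eqP.
by rewrite /= row4E mxE eq_sym oner_eq0.
Qed.
End JumpFamily.

Theorem theorem3p3p3 (R : realType) :
  exists phi : nat -> svec R[i] 4 2 -> svec R[i] 4 2 -> svec R[i] 4 2,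
    [/\ metric_deformation (@g4232 R[i]) phi,
        ~ trivial_deformation (@g4232 R[i]) phi,
        (forall phi' : nat -> svec R[i] 4 2 -> svec R[i] 4 2 -> svec R[i] 4 2,
           metric_deformation (@g4232 R[i]) phi' ->
           ~ trivial_deformation (@g4232 R[i]) phi' ->
           exists2 s : fps R[i], parameter_change s &
             equivalent_deformations phi' (reparametrize s phi))
      & jump_deformation (@g4232 R[i]) phi
          (lie_dsum (@osp12 R[i]) (@lie_abelian R[i] 1 0))].
Proof.
exists (@jump_family R[i]); split.
- exact: jump_family_metric_deformation.
- exact: jump_family_nontrivial.
- move=> phi' /deformation_normal_form[s [h [s0 h2 equiv]]] nontrivial.
  exists s; last by rewrite (reparametrize_jump_family h2 s0).
  split=> // s_eq0; apply: nontrivial.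
  by rewrite /trivial_deformation (constant_deformation_g4232 h2 s_eq0).
- split; last exact: target_not_g4232.
    by have [] := jump_family_metric_deformation R[i].
  (* The radius 1 is arbitrary: the isomorphism exists for every non-zero t. *)
  exists 1; first exact: ltr01.
  move=> t /andP[t_gt0 _]; exists (family_bracket 2^-1 (t / 2)); split.
    exact: jump_family_bracket_at.
  by apply: jump_family_iso; rewrite -normr_gt0.
Qed.
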